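(* Let $v_\bullet$ satisfy (V1)-(V3) and let $f_\bullet$ satisfy (A1)-(A3) (conditions spelled out in the context). Assume that $f_\bullet$ is of the form $$f_t(\mu)=p_t(\mu)+F_t(\mu)\cdot\mu,\qquad t\ge 0,\ \mu\in\mathcal{M}(\Omega),$$ with maps $p_\bullet:\mathbb{R}_+\times\mathcal{M}(\Omega)\to\mathcal{M}^+(\Omega)$ and $F_\bullet:\mathbb{R}_+\times\mathcal{M}(\Omega)\to\mathrm{BL}(\Omega)$. Assume that $F_\bullet$ is such that for every $R>0$ and $T>0$ there exists $C'_{R,T}>0$ such that $$\sup_{0\le t\le T}\|F_t(\mu)\|_\infty\le C'_{R,T}\qquad\text{for all }\mu\in\mathcal{M}^+(\Omega)\text{ with }\|\mu\|_{\mathrm{TV}}\le R.$$ Let $t_0\ge 0$ and $\nu\in\mathcal{M}^+(\Omega)$. Then the maximal mild solution $\mu_\bullet$ to Problem (P) with initial condition $\mu_{t_0}=\nu$ is positive for all its time of existence, i.e. $\mu_t\in\mathcal{M}^+(\Omega)$ for all $t$ in its maximal interval of existence.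
   Context: $\Omega$ is either $\mathbb{R}^d$ or the torus $\mathbb{T}^d=\mathbb{R}^d/\mathbb{Z}^d$ with the Euclidean-based metric. $\mathcal{M}(\Omega)$: finite signed Borel (Radon) measures on $\Omega$; $\mathcal{M}^+(\Omega)$: the positive ones. For a Lipschitz function $g$, $|g|_L$ is its Lipschitz constant. $\mathrm{BL}(\Omega)$: bounded Lipschitz real functions, with norm $\|g\|_{\mathrm{FM}}=\max(\|g\|_\infty,|g|_L)$; $\mathrm{BL}(\Omega,\mathbb{R}^d)$ is defined analogously. $\|\mu\|_{\mathrm{FM}}^*=\sup\{\int g\,d\mu: g\in\mathrm{BL}(\Omega),\|g\|_\infty\le1,|g|_L\le1\}$; $\|\mu\|_{\mathrm{TV}}=|\mu|(\Omega)$; $\mathcal{M}_R(\Omega)=\{\mu\in\mathcal{M}(\Omega):\|\mu\|_{\mathrm{TV}}\le R\}$. $\mathcal{M}(\Omega)_{\mathrm{FM}}$ is $\mathcal{M}(\Omega)$ with norm $\|\cdot\|_{\mathrm{FM}}^*$, and $\overline{\mathcal{M}}(\Omega)_{\mathrm{FM}}$ its completion. $g\cdot\mu$ is the measure with density $g$ with respect to $\mu$. Velocity field $v_t:\Omega\to\mathbb{R}^d$, $t\ge0$: (V1) $(t,x)\mapsto v_t(x)$ is continuous; (V2) $x\mapsto v_t(x)$ is bounded and globally Lipschitz for each $t\ge0$; (V3) $t\mapsto v_t:\mathbb{R}_+\to\mathrm{BL}(\Omega,\mathbb{R}^d)$ is continuous. For $0\le s\le t$, $\Phi^v_{s,t}:\Omega\to\Omega$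 is the flow map: $t\mapsto\Phi^v_{s,t}(x_0)$ is the unique global solution of $\dot x(t)=v_t(x(t))$, $t>s$, $x(s)=x_0$. $P^v_{s,t}\mu:=(\Phi^v_{s,t})_\#\mu$ (push-forward). Reaction map $f:(t,\mu)\mapsto f_t(\mu)\in\mathcal{M}(\Omega)$: (A1) $f:\mathbb{R}_+\times\mathcal{M}(\Omega)_{\mathrm{FM}}\to\mathcal{M}(\Omega)_{\mathrm{FM}}$ is jointly continuous; (A2) for every $T\ge0$ and $R>0$ there exists $L>0$ such that $\|f_t(\mu_1)-f_t(\mu_2)\|_{\mathrm{FM}}^*\le L\|\mu_1-\mu_2\|_{\mathrm{FM}}^*$ for all $\mu_1,\mu_2\in\mathcal{M}_R(\Omega)$ and $t\in[0,T]$; (A3) for every $R>0$ there exists $C^f_R>0$ such that $\|f_t(\mu)\|_{\mathrm{TV}}\le C^f_R$ for all $\mu\in\mathcal{M}_R(\Omega)$, $t\ge0$. Problem (P): $\partial_t\mu_t+\mathrm{div}_x(v_t(x)\mu_t)=f_t(\mu_t)$ with $\mu_{t_0}=\nu$. A mild solution on $[t_0,T]$ is a continuous map $\mu_\bullet:[t_0,T]\to\mathcal{M}(\Omega)_{\mathrm{FM}}$ with $\sup_{t\in[t_0,T]}\|\mu_t\|_{\mathrm{TV}}<\infty$ and $\mu_t=P^v_{t_0,t}\nu+\int_{t_0}^tP^v_{s,t}[f_s(\mu_s)]\,ds$ for $t\in[t_0,T]$ (Bochner integral in $\overline{\mathcal{M}}(\Omega)_{\mathrm{FM}}$). Under (V1)-(V3),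 (A1)-(A3) there is, for each $\nu\in\mathcal{M}(\Omega)$ and $t_0\ge 0$, a unique maximal mild solution on a maximal interval of existence $[t_0,T^* )$, $T^*\in(t_0,\infty]$: its restriction to each $[t_0,T]$, $T<T^*$, is a mild solution, and it cannot be extended further. *)

(* Defs.v *)
From HB Require Import structures.
From mathcomp Require Export all_boot all_order all_algebra.
From mathcomp Require Export all_classical all_reals all_analysis.
From mathcomp Require Import generic_quotient.

Set Implicit Arguments.
Unset Strict Implicit.
Unset Printing Implicit Defensive.

Import Order.TTheory GRing.Theory Num.Theory.
Export numFieldNormedType.Exports.

Local Open Scope classical_set_scope.
Local Open Scope ring_scope.
Local Open Scope quotient_scope.

Section euclidean.
Context {R : realType} {d : nat}.

(* The library's norm on 'rV[R]_d is the sup norm. *)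
Definition enorm (x : 'rV[R]_d) : R := Num.sqrt (\sum_i x ord0 i ^+ 2).

End euclidean.

Section torus.
Context {R : realType} {d : nat}.

Definition lattice_rel (x y : 'rV[R]_d) : bool :=
  [forall i, x ord0 i - y ord0 i \is a Num.int].

Lemma lattice_rel_equiv : equiv_class_of lattice_rel.
Proof.
split=> [x|x y|y x z].
- by apply/forallP => i; rewrite subrr rpred0.
- by apply: eq_forallb => i; rewrite -opprB rpredN.
- move=> /forallP xy /forallP yz; apply/forallP => i.
  by rewrite -(subrKA (y ord0 i)) rpredD.
Qed.

Canonical lattice_equiv := EquivRelPack lattice_rel_equiv.

(* R^d / Z^d *)
Definition torus : Type := {eq_quot lattice_equiv}.

HB.instance Definition _ := Choice.on torus.
HB.instance Definition _ := Quotient.on torus.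
HB.instance Definition _ := isPointed.Build torus (\pi_torus (0 : 'rV[R]_d)).

(* The quotient metric of the Euclidean one. *)
Definition torus_dist (x y : torus) : R :=
  inf [set enorm (a - b) | a in [set a : 'rV[R]_d | \pi_torus a = x] &
                           b in [set b : 'rV[R]_d | \pi_torus b = y]].

End torus.
Arguments torus : clear implicits.

Variant domain := Euclidean | Torus.

Section space.
Context (R : realType) (d : nat).

Definition carrier (k : domain) : pointedType :=
  match k with
  | Euclidean => 'rV[R]_d
  | Torus => torus R d
  end.

Definition proj (k : domain) : 'rV[R]_d -> carrier k :=
  match k return 'rV[R]_d -> carrier k with
  | Euclidean => fun x => x
  | Torus => fun x => \pi_(torus R d) x
  end.

Definition dist {k : domain} : carrier k -> carrier k -> R :=
  match k return carrier k -> carrier k -> R with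
  | Euclidean => fun x y => enorm (x - y)
  | Torus => @torus_dist R d
  end.

Definition dist_open (k : domain) : set (set (carrier k)) :=
  [set A | forall x, A x ->
     exists2 e : R, 0 < e & forall y, dist x y < e -> A y].

(* The space Omega with its Borel sigma-algebra. *)
Definition Omega (k : domain) := g_sigma_algebraType (@dist_open k).

(* Charges are finite by definition. *)
Definition Mspace (k : domain) : Type := {charge set (Omega k) -> \bar R}.

End space.

Definition absr {R : realType} (r : R) : R := `|r|.

(* Continuity, relative to the set D, of a map between two sets equipped with
   (possibly extended) distances. *)
Definition continuous_for {R : realType} {X Y : Type}
    (dX : X -> X -> \bar R) (dY : Y -> Y -> \bar R) (D : set X) (h : X -> Y) :=
  forall x, D x -> forall e : R, 0 < e -> exists2 r : R, 0 < r &
    forall x', D x' -> (dX x x' < r%:E)%E -> (dY (h x) (h x') < e%:E)%E.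

Definition prod_dist {R : realType} {X Y : Type}
    (dX : X -> X -> \bar R) (dY : Y -> Y -> \bar R) (p q : X * Y) : \bar R :=
  maxe (dX p.1 q.1) (dY p.2 q.2).

Definition real_dist {R : realType} (s t : R) : \bar R := `|s - t|%:E.

Section bounded_lipschitz.
Context {R : realType} {d : nat} {k : domain}.
Local Notation X := (Omega R d k).

(* [V] is either [R] with [absr] or 'rV[R]_d with [enorm]. *)
Context {V : zmodType} (nrm : V -> R).
Implicit Type g : X -> V.

Definition sup_norm g : \bar R := ereal_sup [set (nrm (g x))%:E | x in setT].

(* The pairs with x = y contribute 0, as 0 / 0 = 0. *)
Definition lip_const g : \bar R :=
  ereal_sup [set (nrm (g p.1 - g p.2) / dist p.1 p.2)%:E | p in [set: X * X]].

Definition bl_norm g : \bar R := maxe (sup_norm g) (lip_const g).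

Definition BL g := (bl_norm g < +oo)%E.

End bounded_lipschitz.

Section charges.
Context {dsp : measure_display} {T : measurableType dsp} {R : realType}.
Local Open Scope ereal_scope.
Implicit Types mu nu : {charge set T -> \bar R}.

Lemma hahn_exists mu : exists PN, hahn_decomposition mu PN.1 PN.2.
Proof. by have [P [N PN]] := Hahn_decomposition mu; exists (P, N). Qed.

Definition pos_part mu : {finite_measure set T -> \bar R} :=
  jordan_pos (svalP (cid (hahn_exists mu))).

Definition neg_part mu : {finite_measure set T -> \bar R} :=
  jordan_neg (svalP (cid (hahn_exists mu))).

Definition tv_norm mu : \bar R :=
  charge_variation (svalP (cid (hahn_exists mu))) setT.

Definition charge_integral mu (A : set T) (g : T -> R) : \bar R :=
  \int[pos_part mu]_(x in A) (g x)%:E - \int[neg_part mu]_(x in A) (g x)%:E.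

Definition positive_charge mu := forall A, measurable A -> 0 <= mu A.

(* Push-forward along a measurable map; the value for a non-measurable map is
   irrelevant. *)
Definition push (phi : T -> T) mu : {charge set T -> \bar R} :=
  match pselect (measurable_fun setT phi) with
  | left mphi => measure_function_pushforward__canonical__charge_Charge mu mphi
  | right _ => czero
  end.

End charges.

Section bochner.
Context {dsp : measure_display} {T : measurableType dsp} {R : realType}.
Context {B : completeNormedModType R}.
Variable (m : {measure set T -> \bar R}) (D : set T).

Definition bochner_simple (s : T -> B) :=
  finite_set (range s) /\ forall y, measurable (s @^-1` [set y]).

Definition bochner_sintegral (s : T -> B) : B :=
  \sum_(y \in [set: B]) fine (m (D `&` s @^-1` [set y])) *: y.

(* h is Bochner integrable over D and its integral is I: h is the a.e. limit of
   simple functions that also converge to h in L^1, and their integrals tend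
   to I. *)
Definition bochner_integral_is (h : T -> B) (I : B) :=
  exists s : nat -> T -> B,
  [/\ forall n, bochner_simple (s n),
      {ae m, forall t, D t -> s n t @[n --> \oo] --> h t},
      (\int[m]_(t in D) `|h t - s n t|%:E)%E @[n --> \oo] --> 0%E &
      bochner_sintegral (s n) @[n --> \oo] --> I].

End bochner.

Section transport.
Context {R : realType} {d : nat} {k : domain}.
Local Notation X := (Omega R d k).
Local Notation M := (Mspace R d k).

Definition fm_norm (mu : M) : \bar R :=
  ereal_sup [set charge_integral mu setT g | g in
    [set g : X -> R | [/\ BL absr g, (sup_norm absr g <= 1)%E &
                          (lip_const absr g <= 1)%E]]].

Definition fm_dist (mu nu : M) : \bar R := fm_norm (cadd mu (copp nu)).

Definition velocity_field (v : R -> X -> 'rV[R]_d) :=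
  [/\ continuous_for (prod_dist real_dist (fun x y : X => (dist x y)%:E))
        (fun a b => (enorm (a - b))%:E)
        [set p | 0 <= p.1] (fun p => v p.1 p.2),
      forall t, 0 <= t -> BL enorm (v t) &
      continuous_for real_dist
        (fun g h : X -> 'rV[R]_d => bl_norm enorm (fun x => g x - h x))
        [set t | 0 <= t] v].

(* x solves x'(t) = v_t(x(t)) for t > s and x(s) = x0; on the torus the curve
   is differentiated through a lift to R^d. *)
Definition characteristic (v : R -> X -> 'rV[R]_d) (s : R) (x0 : X)
    (x : R -> X) :=
  x s = x0 /\ exists Y : R -> 'rV[R]_d,
  [/\ forall t, s <= t -> x t = proj k (Y t),
      {within `[s, +oo[, continuous Y} &
      forall t : R, s < t -> is_derive t 1 Y (v t (x t))].

Definition flow_map (v : R -> X -> 'rV[R]_d) (Phi : R -> R -> X -> X) :=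
  forall s, 0 <= s -> forall x0, characteristic v s x0 (fun t => Phi s t x0).

Definition reaction_map (f : R -> M -> M) :=
  [/\ continuous_for (prod_dist real_dist fm_dist) fm_dist
        [set p | 0 <= p.1] (fun p => f p.1 p.2),
      forall T r : R, 0 <= T -> 0 < r -> exists2 L : R, 0 < L &
        forall (mu1 mu2 : M) t, (tv_norm mu1 <= r%:E)%E ->
          (tv_norm mu2 <= r%:E)%E -> 0 <= t <= T ->
          (fm_dist (f t mu1) (f t mu2) <= L%:E * fm_dist mu1 mu2)%E &
      forall r : R, 0 < r -> exists2 C : R, 0 < C &
        forall (mu : M) t, (tv_norm mu <= r%:E)%E -> 0 <= t ->
          (tv_norm (f t mu) <= C%:E)%E].

(* [B], with the embedding [iota], is the completion of M(Omega)_FM. *)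
Definition is_fm_completion (B : completeNormedModType R) (iota : M -> B) :=
  [/\ forall (a : R) (mu nu : M),
        iota (cadd (cscale a mu) nu) = a *: iota mu + iota nu,
      forall mu, `|iota mu|%:E = fm_norm mu &
      dense (range iota)].

Section mild.
Variables (Phi : R -> R -> X -> X) (f : R -> M -> M).
Variables (B : completeNormedModType R) (iota : M -> B).
Variables (t0 : R) (nu : M).

Definition mild_solution (T : R) (mu : R -> M) :=
  [/\ continuous_for real_dist fm_dist `[t0, T] mu,
      (ereal_sup [set tv_norm (mu t) | t in `[t0, T]] < +oo)%E &
      forall t, t0 <= t <= T -> exists2 I : B,
        bochner_integral_is lebesgue_measure `[t0, t]
          (fun s => iota (push (Phi s t) (f s (mu s)))) I &
        iota (mu t) = iota (push (Phi t0 t) nu) + I].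

(* mu is a mild solution on [t0, Tmax[ that cannot be extended; only the values
   of mu on that interval matter. *)
Definition maximal_mild_solution (Tmax : \bar R) (mu : R -> M) :=
  [/\ (t0%:E < Tmax)%E,
      forall T : R, t0 < T -> (T%:E < Tmax)%E -> mild_solution T mu &
      ~ exists (T : R) (mu' : R -> M),
        [/\ (Tmax <= T%:E)%E, mild_solution T mu' &
            forall t, t0 <= t -> (t%:E < Tmax)%E -> mu' t = mu t]].

End mild.
End transport.

(* Main.v *)
Require Import Defs.
From mathcomp Require Import generic_quotient measurable_realfun lra ring.

Set Implicit Arguments.
Unset Strict Implicit.
Unset Printing Implicit Defensive.

Import Order.TTheory GRing.Theory Num.Theory.
Local Open Scope classical_set_scope.
Local Open Scope ring_scope.

(** Why positivity is preserved.  In the Fortet-Mourier norm, let D(t) be the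
    distance from the solution mu_t to the convex cone of positive charges.
    The theorem says that D vanishes.  This is a viability argument: the cone
    is closed, and the vector field nearly points into it.

    Fix t and choose a positive charge m almost as close to mu_t as D(t).  The
    mass of m is controlled by that of mu_t, so the per capita rate F_t(m) is
    bounded by a constant C' that does not depend on m, and for h C' <= 1 the
    Euler step m + h f_t(m) >= (1 - h C') m is still positive
    (positive_euler).  Note that C' is only available at positive charges;
    evaluating f at m rather than at mu_t is what makes the argument work, the
    price being L |mu_t - m| by the Lipschitz condition on f.  The push-forward
    along the flow from t to t + h keeps the Euler step positive and expands
    distances by at most exp (C h).  Since mu_(t + h) agrees with the
    transported Euler step of mu_t up to o(h), this gives
      D(t + h) <= exp ((C + L) h) D(t) + o(h),
    and as D is continuous and starts from 0 it remains 0
    (forward_gronwall).  No positive solution has to be constructed.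

    Everything is read off from pairings with bounded Lipschitz functions g.
    - The integral of g extends to a continuous linear functional on the
      completion (pairing_extension) and so passes through the Bochner integral
      (bochner_integral_functional).  The mild formulation becomes a family of
      scalar identities, which the flow property turns into a Duhamel formula
      started at any time t (duhamel) and then into the Euler expansion
      (euler_step), uniformly in g.
    - The flow is Lipschitz in space, has bounded speed and satisfies
      Phi_(t,r) o Phi_(s,t) = Phi_(s,r), by Gronwall's inequality for lifts to
      the Euclidean space (lift_gronwall).
    - A charge with D = 0 pairs nonnegatively with every nonnegative bounded
      Lipschitz function; these approximate indicators of Borel sets in L^1 of
      any finite measure, so the charge is positive (positive_of_pairing). *)

(** * The Euclidean norm and the metric of the domain *)

Section euclidean_norm.
Context {R : realType} {d : nat}.
Implicit Types x y : 'rV[R]_d.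

Definition dotv x y : R := \sum_i x ord0 i * y ord0 i.

Lemma dotvC x y : dotv x y = dotv y x.
Proof. by apply: eq_bigr => i _; rewrite mulrC. Qed.

Lemma dotvDl x y z : dotv (x + y) z = dotv x z + dotv y z.
Proof. by rewrite -big_split; apply: eq_bigr => i _; rewrite mxE mulrDl. Qed.

Lemma dotvZl a x y : dotv (a *: x) y = a * dotv x y.
Proof. by rewrite mulr_sumr; apply: eq_bigr => i _; rewrite mxE mulrA. Qed.

Lemma dotvNl x y : dotv (- x) y = - dotv x y.
Proof. by rewrite -scaleN1r dotvZl mulN1r. Qed.

Lemma dotvDr x y z : dotv z (x + y) = dotv z x + dotv z y.
Proof. by rewrite dotvC dotvDl !(dotvC z). Qed.

Lemma dotvZr a x y : dotv y (a *: x) = a * dotv y x.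
Proof. by rewrite dotvC dotvZl dotvC. Qed.

Lemma dotvNr x y : dotv x (- y) = - dotv x y.
Proof. by rewrite dotvC dotvNl dotvC. Qed.

Lemma dotvv_ge0 x : 0 <= dotv x x.
Proof. by apply: sumr_ge0 => i _; rewrite -expr2 sqr_ge0. Qed.

Lemma enorm_ge0 x : 0 <= enorm x.
Proof. exact: sqrtr_ge0. Qed.

Lemma enorm_sqr x : enorm x ^+ 2 = dotv x x.
Proof.
rewrite /enorm sqr_sqrtr; first by apply: eq_bigr => i _; rewrite expr2.
by apply: sumr_ge0 => i _; rewrite sqr_ge0.
Qed.

Lemma enorm_coord x i : `|x ord0 i| <= enorm x.
Proof.
rewrite -(@ler_pXn2r _ 2) ?nnegrE ?enorm_ge0//.
rewrite enorm_sqr real_normK ?num_real// /dotv (bigD1 i)//= expr2 lerDl.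
by apply: sumr_ge0 => j _; rewrite -expr2 sqr_ge0.
Qed.

Lemma enorm0_eq0 x : enorm x = 0 -> x = 0.
Proof.
move=> x0; apply/rowP => i; rewrite mxE; apply/eqP.
by rewrite -normr_le0 -x0 enorm_coord.
Qed.

Lemma enorm0 : enorm (0 : 'rV[R]_d) = 0.
Proof.
rewrite /enorm big1 ?sqrtr0// => i _.
by rewrite mxE expr0n.
Qed.

Lemma enormN x : enorm (- x) = enorm x.
Proof. by congr Num.sqrt; apply: eq_bigr => i _; rewrite mxE sqrrN. Qed.

Lemma enormB_sym x y : enorm (x - y) = enorm (y - x).
Proof. by rewrite -opprB enormN. Qed.

(** Cauchy-Schwarz, from the square of |y| x - |x| y. *)
Lemma dotv_le x y : dotv x y <= enorm x * enorm y.
Proof.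
have [x0|x0] := eqVneq (enorm x) 0.
  by rewrite x0 (enorm0_eq0 x0) -(scale0r 0) dotvZl !mul0r.
have [y0|y0] := eqVneq (enorm y) 0.
  by rewrite y0 (enorm0_eq0 y0) -(scale0r 0) dotvZr mul0r mulr0.
have a0 : 0 < enorm x by rewrite lt0r x0 enorm_ge0.
have b0 : 0 < enorm y by rewrite lt0r y0 enorm_ge0.
have := dotvv_ge0 (enorm y *: x - enorm x *: y).
rewrite !(dotvDl, dotvDr, dotvNl, dotvNr, dotvZl, dotvZr) -!enorm_sqr.
rewrite (dotvC y x).
move: (enorm x) (enorm y) (dotv x y) a0 b0 => a b c a0 b0 h.
have ab0 : 0 < a * b by rewrite mulr_gt0.
rewrite -(ler_pM2l ab0); nra.
Qed.

Lemma enormD x y : enorm (x + y) <= enorm x + enorm y.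
Proof.
rewrite -(@ler_pXn2r _ 2) ?nnegrE ?enorm_ge0 ?addr_ge0 ?enorm_ge0//.
rewrite enorm_sqr dotvDl !dotvDr (dotvC y x).
have := dotv_le x y; rewrite -!enorm_sqr; nra.
Qed.

Lemma enormB_triangle x y z : enorm (x - z) <= enorm (x - y) + enorm (y - z).
Proof. by rewrite -(subrKA y x) enormD. Qed.

End euclidean_norm.

Section domain_metric.
Context {R : realType} {d : nat} {k : domain}.
Local Notation X := (carrier R d k).
Local Notation V := 'rV[R]_d.
Implicit Types (x y z : X) (a b c : V).

Lemma proj_surj x : exists a, proj k a = x.
Proof.
case: k x => x /=; first by exists x.
by exists (repr x); rewrite reprK.
Qed.

Lemma proj_addr a b c : proj k a = proj k b -> proj k (a + c) = proj k (b + c).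
Proof.
case: k => /= [->//|/eqmodP/= ab]; apply/eqmodP => /=.
apply/forallP => i; move/forallP : ab => /(_ i).
by rewrite !mxE opprD addrACA subrr addr0.
Qed.

Lemma dist_le_enorm a b : dist (proj k a) (proj k b) <= enorm (a - b).
Proof.
case: k => //=; apply: ge_inf; last by exists a => //; exists b.
by exists 0 => _ [u _ [w _ <-]]; exact: enorm_ge0.
Qed.

Lemma le_distP (e : R) x y :
  (forall a b, proj k a = x -> proj k b = y -> e <= enorm (a - b)) ->
  e <= dist x y.
Proof.
move=> h; move: (proj_surj x) (proj_surj y) h => [a ax] [b bx].
case: k x y ax bx => /= x y ax bx h; first exact: h.
apply: lb_le_inf; first by exists (enorm (a - b)), a => //; exists b.
by move=> _ [u ux [w wx <-]]; apply: h.
Qed.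

Lemma dist_ge0 x y : 0 <= dist x y.
Proof. by apply: le_distP => *; exact: enorm_ge0. Qed.

Lemma distxx x : dist x x = 0.
Proof.
have [a <-] := proj_surj x; apply/eqP; rewrite eq_le dist_ge0 andbT.
by rewrite (le_trans (dist_le_enorm _ _))// subrr enorm0.
Qed.

Lemma dist_sym x y : dist x y = dist y x.
Proof.
suff h (u w : X) : dist u w <= dist w u by apply/eqP; rewrite eq_le !h.
apply: le_distP => a b <- <-; rewrite enormB_sym; exact: dist_le_enorm.
Qed.

(** The middle point has different lifts in the two distances; the lift of
    the end point is translated to compensate. *)
Lemma dist_triangle y x z : dist x z <= dist x y + dist y z.
Proof.
rewrite -lerBlDr; apply: le_distP => a b <- bE.
rewrite lerBlDl -lerBlDr; apply: le_distP => b' c b'E <-.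
rewrite lerBlDr.
have -> : proj k c = proj k (c + (b - b')).
  have := proj_addr (c - b') (etrans bE (esym b'E)).
  by rewrite [b' + _]addrCA subrr addr0 addrCA => <-; congr proj; rewrite addrCA.
apply: (le_trans (dist_le_enorm _ _)).
apply: (le_trans (enormB_triangle a b _)).
by rewrite addrC lerD2r (_ : b - (c + (b - b')) = b' - c)//;
   apply/rowP => i; rewrite !mxE; ring.
Qed.

Lemma dist_lt_lift (e : R) x y : dist x y < e ->
  exists a b, [/\ proj k a = x, proj k b = y & enorm (a - b) < e].
Proof.
move=> xye; apply: contrapT => h; move: xye; apply/negP; rewrite -leNgt.
apply: le_distP => a b ax bx; rewrite leNgt; apply/negP => abe.
by apply: h; exists a, b.
Qed.

(** On the torus the point is that the lattice is discrete: differences of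
    lifts of the same pair of points agree up to integers in each coordinate,
    so once they are small they are equal, and being arbitrarily small they
    vanish. *)
Lemma dist0_eq x y : dist x y = 0 -> x = y.
Proof.
move=> xy0.
have lift (e : R) : 0 < e ->
    exists a b, [/\ proj k a = x, proj k b = y & enorm (a - b) < e].
  by move=> e0; apply: dist_lt_lift; rewrite xy0.
have [|a [b [ax bx ab]]] := lift 4^-1; first by rewrite invr_gt0.
suff -> : x = proj k b by [].
rewrite -ax; congr proj; apply/eqP; rewrite -subr_eq0; apply/eqP/rowP => i.
rewrite [RHS]mxE; apply/eqP; rewrite -normr_le0; apply/ler_addgt0Pr => e e0.
rewrite add0r.
have [|a' [b' [ax' bx' ab']]] := lift (Num.min e 4^-1).
  by rewrite lt_min e0 invr_gt0 ltr0n.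
have close : `|(a - b) ord0 i - (a' - b') ord0 i| < 1.
  have := le_lt_trans (enorm_coord (a - b) i) ab.
  have := le_lt_trans (enorm_coord (a' - b') i) ab'.
  rewrite lt_min => /andP[_]; rewrite !ltr_norml; lra.
suff -> : (a - b) ord0 i = (a' - b') ord0 i.
  apply: ltW; apply: (le_lt_trans (enorm_coord _ _)); apply: (lt_le_trans ab').
  by rewrite ge_min lexx.
move: close; case: k x y ax bx ax' bx' {xy0 lift} => /= x y.
  by move=> -> -> -> ->.
move=> <- <- /eqmodP/= /forallP/(_ i) aa /eqmodP/= /forallP/(_ i) bb h.
apply/eqP; rewrite -subr_eq0; apply/negPn/negP => nz; move: h; apply/negP.
rewrite -leNgt; apply: Num.Theory.norm_intr_ge1 => //.
have -> : (a - b) ord0 i - (a' - b') ord0 i =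
    (b' ord0 i - b ord0 i) - (a' ord0 i - a ord0 i) by rewrite !mxE; ring.
by rewrite rpredB.
Qed.

End domain_metric.

(** * Integration of bounded functions against charges *)

Section charge_pairing.
Context {dsp : measure_display} {T : measurableType dsp} {R : realType}.
Local Notation chargeT := (charge T R).
Implicit Types (m : chargeT) (a b : {measure set T -> \bar R}) (g : T -> R).

Definition bounded_measurable g :=
  measurable_fun setT g /\ exists C : R, forall x, `|g x| <= C.

Definition pairing m g : R := fine (charge_integral m setT g).

Lemma bounded_measurable_integrable a g : fin_num_fun a ->
  bounded_measurable g -> a.-integrable setT (EFin \o g).
Proof.
move=> fa [mg [C gC]]; apply: measurable_bounded_integrable => //.
  by rewrite ltey_eq fa.
exists C; split; first exact: num_real.
by move=> M CM x _; exact: le_trans (gC x) (ltW CM).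
Qed.

Lemma fin_pos_part m : fin_num_fun (pos_part m).
Proof. by move=> A mA; rewrite fin_num_measure. Qed.

Lemma fin_neg_part m : fin_num_fun (neg_part m).
Proof. by move=> A mA; rewrite fin_num_measure. Qed.

Lemma pairingE m g : bounded_measurable g ->
  pairing m g =
  \int[pos_part m]_(x in setT) g x - \int[neg_part m]_(x in setT) g x.
Proof.
move=> bg; rewrite /pairing /charge_integral fineB//;
  apply: integrable_fin_num => //; apply: bounded_measurable_integrable => //.
Qed.

Lemma charge_integralE m g : bounded_measurable g ->
  charge_integral m setT g = (pairing m g)%:E.
Proof.
move=> bg; rewrite /pairing fineK// /charge_integral fin_numB; apply/andP.
split; apply: integrable_fin_num => //; apply: bounded_measurable_integrable => //.
Qed.

Lemma jordan_partsE m A : measurable A -> m A = (pos_part m A - neg_part m A)%E.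
Proof.
move=> mA; rewrite {1}(jordan_decomp (svalP (cid (hahn_exists m))) mA).
by rewrite /cadd /= cscaleN1.
Qed.

Lemma Rintegral_measure_add a b g : fin_num_fun a -> fin_num_fun b ->
  bounded_measurable g ->
  \int[measure_add a b]_(x in setT) g x =
  \int[a]_(x in setT) g x + \int[b]_(x in setT) g x.
Proof.
move=> fa fb bg; have ia := bounded_measurable_integrable fa bg.
have ib := bounded_measurable_integrable fb bg.
by rewrite /Rintegral integral_measure_add// fineD//; exact: integrable_fin_num.
Qed.

Lemma Rintegral_mscale (k : {nonneg R}) a g : fin_num_fun a ->
  bounded_measurable g ->
  \int[mscale k a]_(x in setT) g x = k%:num * \int[a]_(x in setT) g x.
Proof.
move=> fa bg; have ia := bounded_measurable_integrable fa bg.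
have mg := measurable_int _ ia.
rewrite /Rintegral integralE [in RHS]integralE.
rewrite !ge0_integral_mscale//; last 2 first.
- exact: (measurable_funeneg mg).
- exact: (measurable_funepos mg).
have fp : (\int[a]_x ((EFin \o g)^\+ x) \is a fin_num)%E.
  by apply: integrable_fin_num => //; exact: integrable_funepos.
have fn : (\int[a]_x ((EFin \o g)^\- x) \is a fin_num)%E.
  by apply: integrable_fin_num => //; exact: integrable_funeneg.
by move: fp fn => /fineK <- /fineK <-; rewrite /= mulrBr.
Qed.

(** The pairing can be computed from any decomposition of the charge as a
    difference of two finite measures: the integrals of a function against two
    such decompositions agree, because the crossed sums of measures do. *)
Lemma pairing_diff m a b g : fin_num_fun a -> fin_num_fun b ->
  (forall A, measurable A -> m A = a A - b A)%E -> bounded_measurable g ->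
  pairing m g = \int[a]_(x in setT) g x - \int[b]_(x in setT) g x.
Proof.
move=> fa fb mab bg; rewrite pairingE//.
have fp := @fin_pos_part m; have fn := @fin_neg_part m.
suff : \int[measure_add (pos_part m) b]_(x in setT) g x =
       \int[measure_add (neg_part m) a]_(x in setT) g x.
  by rewrite !Rintegral_measure_add//; lra.
congr fine; apply: eq_measure_integral => A mA _.
apply: (etrans (measure_addE _ _ _)); apply/esym.
apply: (etrans (measure_addE _ _ _)); apply/esym.
change (pos_part m A + b A = neg_part m A + a A)%E.
have := jordan_partsE m mA; rewrite mab//.
move: (fa A mA) (fb A mA) (fp A mA) (fn A mA).
move: (a A) (b A) (pos_part m A) (neg_part m A) => [r1| |] [r2| |] [r3| |] [r4| |]//.
by move=> _ _ _ _ [h]; rewrite -?EFinN -?EFinM -?EFinD; congr (_%:E); lra.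
Qed.

Lemma fin_measure_add a b : fin_num_fun a -> fin_num_fun b ->
  fin_num_fun (measure_add a b).
Proof. by move=> fa fb A mA; rewrite measure_addE fin_numD fa// fb. Qed.

Lemma pairing_cadd m1 m2 g : bounded_measurable g ->
  pairing (cadd m1 m2) g = pairing m1 g + pairing m2 g.
Proof.
move=> bg.
have fp1 := @fin_pos_part m1; have fn1 := @fin_neg_part m1.
have fp2 := @fin_pos_part m2; have fn2 := @fin_neg_part m2.
rewrite (@pairing_diff _ (measure_add (pos_part m1) (pos_part m2))
          (measure_add (neg_part m1) (neg_part m2)))//; last 3 first.
- exact: fin_measure_add.
- exact: fin_measure_add.
- move=> A mA.
  transitivity (pos_part m1 A + pos_part m2 A -
                (neg_part m1 A + neg_part m2 A))%E; last first.
    by congr (_ - _)%E; apply/esym; exact: measure_addE.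
  transitivity (m1 A + m2 A)%E; first by [].
  rewrite !jordan_partsE//.
  move: (fp1 A mA) (fn1 A mA) (fp2 A mA) (fn2 A mA).
  move: (pos_part m1 A) (neg_part m1 A) (pos_part m2 A) (neg_part m2 A).
  move=> [r1| |] [r2| |] [r3| |] [r4| |]// _ _ _ _.
  rewrite -?EFinN -?EFinM -?EFinD; congr (_%:E); lra.
by rewrite !Rintegral_measure_add// !pairingE//; lra.
Qed.

Lemma pairing_cscale (c : R) m g : bounded_measurable g ->
  pairing (cscale c m) g = c * pairing m g.
Proof.
move=> bg; have fp := @fin_pos_part m; have fn := @fin_neg_part m.
have [c0|c0] := leP 0 c.
- rewrite (@pairing_diff _ (mscale (NngNum c0) (pos_part m))
            (mscale (NngNum c0) (neg_part m)))//; last first.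
    move=> A mA; transitivity (c%:E * m A)%E; first by [].
    transitivity (c%:E * pos_part m A - c%:E * neg_part m A)%E; last by [].
    rewrite jordan_partsE//.
    move: (fp A mA) (fn A mA).
    move: (pos_part m A) (neg_part m A) => [r1| |] [r2| |]// _ _.
    by rewrite -?EFinN -?EFinM -?EFinD; congr (_%:E); lra.
  by rewrite !Rintegral_mscale// pairingE//= mulrBr.
- have Nc0 : 0 <= - c by lra.
  rewrite (@pairing_diff _ (mscale (NngNum Nc0) (neg_part m))
            (mscale (NngNum Nc0) (pos_part m)))//; last first.
    move=> A mA; transitivity (c%:E * m A)%E; first by [].
    transitivity ((- c)%:E * neg_part m A - (- c)%:E * pos_part m A)%E.
      2: by [].
    rewrite jordan_partsE//.
    move: (fp A mA) (fn A mA).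
    move: (pos_part m A) (neg_part m A) => [r1| |] [r2| |]// _ _.
    by rewrite -?EFinN -?EFinM -?EFinD; congr (_%:E); lra.
  by rewrite !Rintegral_mscale// pairingE//=; lra.
Qed.

Lemma eq_pairing m1 m2 g : (forall A, measurable A -> m1 A = m2 A) ->
  bounded_measurable g -> pairing m1 g = pairing m2 g.
Proof.
move=> m12 bg; rewrite pairingE//; apply/esym.
by apply: pairing_diff => // A mA; rewrite -m12// jordan_partsE.
Qed.

Lemma pairing_copp m g : bounded_measurable g ->
  pairing (copp m) g = - pairing m g.
Proof.
move=> bg; rewrite -mulN1r -pairing_cscale//; apply: eq_pairing => // A mA.
transitivity (- m A)%E; first by [].
by rewrite -[RHS]/(cscale (-1) m A) cscaleN1.
Qed.

Lemma pairing_sub m1 m2 g : bounded_measurable g ->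
  pairing (cadd m1 (copp m2)) g = pairing m1 g - pairing m2 g.
Proof. by move=> bg; rewrite pairing_cadd// pairing_copp. Qed.

Lemma pairing_push m (phi : T -> T) g : measurable_fun setT phi ->
  bounded_measurable g -> pairing (push phi m) g = pairing m (g \o phi).
Proof.
move=> mphi bg.
have bgphi : bounded_measurable (g \o phi).
  case: bg => mg [C gC]; split; first exact: measurableT_comp.
  by exists C => x; exact: gC.
have fp := @fin_pos_part m; have fn := @fin_neg_part m.
rewrite /push; case: pselect => // mphi'.
have fin_pf a : fin_num_fun a -> fin_num_fun (pushforward a phi).
  move=> fa A mA; apply: fa; rewrite -[_ @^-1` _]setTI; exact: mphi.
have Rpf a : fin_num_fun a ->
  \int[pushforward a phi]_(x in setT) g x = \int[a]_(x in setT) (g \o phi) x.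
  move=> fa; rewrite /Rintegral integral_pushforward//.
  - by case: bg => mg _; exact: measurableT_comp.
  - by rewrite preimage_setT; exact: bounded_measurable_integrable.
rewrite (@pairing_diff _ (pushforward (pos_part m) phi)
          (pushforward (neg_part m) phi)) ?Rpf ?pairingE//.
- exact: fin_pf.
- exact: fin_pf.
- move=> A mA /=; rewrite /pushforward jordan_partsE//.
  rewrite -[_ @^-1` _]setTI; exact: mphi.
Qed.

End charge_pairing.

Section charge_bounds.
Context {dsp : measure_display} {T : measurableType dsp} {R : realType}.
Local Notation chargeT := (charge T R).
Implicit Types (m : chargeT) (g : T -> R).

Lemma bounded_measurableB g h : bounded_measurable g -> bounded_measurable h ->
  bounded_measurable (fun x => g x - h x).
Proof.
move=> [mg [C gC]] [mh [D hD]]; split; first exact: measurable_funB.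
by exists (C + D) => x; rewrite (le_trans (ler_normB _ _))// lerD.
Qed.

Lemma bounded_measurable_cst (c : R) : bounded_measurable (cst c : T -> R).
Proof. by split; [exact: measurable_cst|exists `|c|]. Qed.

Lemma pairing_subr m g h : bounded_measurable g -> bounded_measurable h ->
  pairing m (fun x => g x - h x) = pairing m g - pairing m h.
Proof.
move=> bg bh; have bgh := bounded_measurableB bg bh.
have fp := @fin_pos_part _ _ _ m; have fn := @fin_neg_part _ _ _ m.
rewrite !pairingE// !RintegralB//; last 4 first.
- exact: bounded_measurable_integrable.
- exact: bounded_measurable_integrable.
- exact: bounded_measurable_integrable.
- exact: bounded_measurable_integrable.
ring.
Qed.

Lemma tv_norm_fin m : tv_norm m \is a fin_num.
Proof.
have fp := @fin_pos_part _ _ _ m; have fn := @fin_neg_part _ _ _ m.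
change ((pos_part m setT + neg_part m setT)%E \is a fin_num).
by rewrite fin_numD fp// fn.
Qed.

Definition tv m : R := fine (tv_norm m).

Lemma tvE m : tv m = fine (pos_part m setT) + fine (neg_part m setT).
Proof.
have fp := @fin_pos_part _ _ _ m; have fn := @fin_neg_part _ _ _ m.
change (fine (pos_part m setT + neg_part m setT)%E =
  fine (pos_part m setT) + fine (neg_part m setT)).
by rewrite fineD ?fp ?fn.
Qed.

Lemma tv_ge0 m : 0 <= tv m.
Proof. by rewrite tvE addr_ge0// fine_ge0. Qed.

Lemma tv_norm_le m (r : R) : (tv_norm m <= r%:E)%E = (tv m <= r).
Proof. by rewrite /tv -[in LHS](fineK (tv_norm_fin m)) lee_fin. Qed.

Lemma normr_Rintegral_le (a : {measure set T -> \bar R}) g (C : R) :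
  fin_num_fun a -> bounded_measurable g -> (forall x, `|g x| <= C) ->
  `|\int[a]_(x in setT) g x| <= C * fine (a setT).
Proof.
move=> fa bg gC; have ia := bounded_measurable_integrable fa bg.
apply: (le_trans (le_normr_Rintegral _ ia)) => //.
rewrite -Rintegral_cst//; apply: le_Rintegral => //.
- exact: integrable_norm.
- exact: (bounded_measurable_integrable fa (bounded_measurable_cst C)).
Qed.

Lemma pairing_le_tv m g (C : R) : bounded_measurable g ->
  (forall x, `|g x| <= C) -> `|pairing m g| <= C * tv m.
Proof.
move=> bg gC; have fp := @fin_pos_part _ _ _ m.
have fn := @fin_neg_part _ _ _ m.
rewrite pairingE// tvE mulrDr (le_trans (ler_normB _ _))// lerD//;
  exact: normr_Rintegral_le.
Qed.

Lemma positive_neg_part0 m A : positive_charge m -> measurable A ->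
  neg_part m A = 0%E.
Proof.
move=> m0 mA; have n0 : (0 <= neg_part m A)%E by [].
apply/eqP; rewrite eq_le n0 andbT.
rewrite /neg_part; case: (svalP (cid (hahn_exists m))) => posP [mN negN] PN0 PNT.
set h := (X in jordan_neg X); change (jordan_neg h A <= 0)%E.
rewrite jordan_negE cjordan_negE /crestr0/= mem_set// /crestr.
by rewrite leeNl oppe0; apply: m0; exact: measurableI.
Qed.

Lemma positive_pos_part m A : positive_charge m -> measurable A ->
  pos_part m A = m A.
Proof. by move=> m0 mA; rewrite [RHS]jordan_partsE// positive_neg_part0// sube0. Qed.

Lemma tv_positive m : positive_charge m -> tv m = pairing m (cst 1).
Proof.
move=> m0; rewrite pairingE; last exact: bounded_measurable_cst.
rewrite !Rintegral_cst// !mul1r tvE.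
have -> : fine (neg_part m setT) = 0 by rewrite positive_neg_part0.
by rewrite addr0 subr0.
Qed.

Lemma positive_integral_ge m A g (C : R) : positive_charge m -> measurable A ->
  bounded_measurable g -> (forall x, `|g x| <= C) ->
  (- (C%:E * m A) <= charge_integral m A g)%E.
Proof.
move=> m0 mA bg gC; have fp := @fin_pos_part _ _ _ m.
have ia := integrableS measurableT mA (@subsetT _ A)
  (bounded_measurable_integrable fp bg).
rewrite /charge_integral [X in (_ - X)%E](_ : _ = 0%E); last first.
  rewrite (eq_measure_integral mzero) ?integral_measure_zero// => B mB _.
  exact: positive_neg_part0.
rewrite sube0 -positive_pos_part//.
have ic : (pos_part m).-integrable A (EFin \o cst (- C)).
  apply: (integrableS measurableT) => //.
  exact: (bounded_measurable_integrable fp (bounded_measurable_cst _)).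
rewrite -mulNe -EFinN -integral_cst//; apply: le_integral => // x _ /=.
by rewrite lee_fin; have := gC x; rewrite ler_norml => /andP[].
Qed.

Lemma pairing_ge0 m g : positive_charge m -> bounded_measurable g ->
  (forall x, 0 <= g x) -> 0 <= pairing m g.
Proof.
move=> m0 bg g0; rewrite pairingE// [X in _ - X](_ : _ = 0).
  by rewrite subr0; exact: Rintegral_ge0.
rewrite /Rintegral (eq_measure_integral mzero) ?integral_measure_zero//.
by move=> B mB _; exact: positive_neg_part0.
Qed.

End charge_bounds.

(** * Bounded Lipschitz functions and the Fortet-Mourier norm *)

Section bl_norm.
Context {R : realType} {d : nat} {k : domain}.
Local Notation X := (Omega R d k).
Context {V : zmodType} {nrm : V -> R}.
Hypothesis nrm0 : nrm 0 = 0.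
Implicit Type g : X -> V.

Lemma sup_norm_leP g (c : R) :
  (sup_norm nrm g <= c%:E)%E <-> forall x, nrm (g x) <= c.
Proof.
split=> [h x|h].
  by rewrite -lee_fin; apply: le_trans h; apply: ereal_sup_ubound; exists x.
by apply: ub_ereal_sup => _ [x _ <-]; rewrite lee_fin.
Qed.

(** The junk value at pairs of equal points does no harm because dist
    separates points. *)
Lemma lip_const_leP g (c : R) : 0 <= c ->
  (lip_const nrm g <= c%:E)%E <-> forall x y, nrm (g x - g y) <= c * dist x y.
Proof.
move=> c0; split=> [h x y|h].
  have [xy0|xyN0] := eqVneq (dist x y) 0.
    by rewrite (dist0_eq xy0) subrr nrm0 distxx mulr0.
  have xy_gt0 : 0 < dist x y by rewrite lt0r xyN0 dist_ge0.
  rewrite -ler_pdivrMr// -lee_fin; apply: le_trans h.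
  by apply: ereal_sup_ubound; exists (x, y).
apply: ub_ereal_sup => _ [[x y] _ <-] /=; rewrite lee_fin.
have [xy0|xyN0] := eqVneq (dist x y) 0; first by rewrite xy0 invr0 mulr0.
have xy_gt0 : 0 < dist x y by rewrite lt0r xyN0 dist_ge0.
by rewrite ler_pdivrMr.
Qed.

Lemma bl_norm_leP g (c : R) : 0 <= c -> (bl_norm nrm g <= c%:E)%E <->
  (forall x, nrm (g x) <= c) /\ (forall x y, nrm (g x - g y) <= c * dist x y).
Proof.
move=> c0; rewrite /bl_norm ge_max; split.
  by move=> /andP[/sup_norm_leP ? /(lip_const_leP _ c0) ?].
by move=> [? ?]; apply/andP; split; [exact/sup_norm_leP|exact/lip_const_leP].
Qed.

Lemma BL_bound g : BL nrm g -> exists2 c : R, 0 < c & (bl_norm nrm g <= c%:E)%E.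
Proof.
rewrite /BL; case: (bl_norm nrm g) => [r _| //|_].
  exists (Num.max r 1); first by rewrite lt_max ltr01 orbT.
  by rewrite lee_fin le_max lexx.
by exists 1 => //; exact: leNye.
Qed.

End bl_norm.

Section fortet_mourier.
Context {R : realType} {d : nat} {k : domain}.
Local Notation X := (Omega R d k).
Local Notation M := (Mspace R d k).
Implicit Types (g : X -> R) (m : M) (c : R).

Definition bounded_lip c g :=
  (forall x, `|g x| <= c) /\ (forall x y, `|g x - g y| <= c * dist x y).

Lemma bounded_lip_ge0 c g : bounded_lip c g -> 0 <= c.
Proof. by move=> [gc _]; exact: le_trans (gc point). Qed.

Lemma dist_open_measurable (A : set X) : dist_open A -> measurable A.
Proof. exact: sub_sigma_algebra. Qed.

Lemma lip_open_preimage (phi : X -> X) c (A : set X) :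
  (forall x y, dist (phi x) (phi y) <= c * dist x y) -> dist_open A ->
  dist_open (phi @^-1` A).
Proof.
move=> phic oA x /oA[e e0 eA].
have c1 : 0 < `|c| + 1 by rewrite ltr_wpDl.
exists (e / (`|c| + 1)); first by rewrite divr_gt0.
move=> y; rewrite ltr_pdivlMr// => xy; apply: eA.
apply: le_lt_trans (phic _ _) (le_lt_trans _ xy).
rewrite mulrC ler_wpM2l ?dist_ge0// (le_trans (ler_norm _))//.
by rewrite lerDl.
Qed.

Lemma lip_measurable (phi : X -> X) c :
  (forall x y, dist (phi x) (phi y) <= c * dist x y) ->
  measurable_fun setT phi.
Proof.
move=> phic; apply: (@measurability _ _ X X setT phi (@dist_open R d k)) => //.
move=> _ [A oA <-]; rewrite setTI; apply: dist_open_measurable.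
exact: lip_open_preimage oA.
Qed.

Lemma bounded_lip_measurable c g : bounded_lip c g -> bounded_measurable g.
Proof.
move=> [gc gl]; split; last by exists c.
apply: (measurability (@RGenOInfty.G R)); first exact: RGenOInfty.measurableE.
move=> _ [_ [a ->] <-]; rewrite setTI; apply: dist_open_measurable => x /=.
rewrite in_itv/= andbT => agx.
have c1 : 0 < `|c| + 1 by rewrite ltr_wpDl.
exists ((g x - a) / (`|c| + 1)); first by rewrite divr_gt0// subr_gt0.
move=> y; rewrite ltr_pdivlMr// in_itv/= andbT => xy.
have := gl x y; rewrite ler_norml => /andP[_ gxy].
have : c * dist x y <= dist x y * (`|c| + 1).
  rewrite mulrC ler_wpM2l ?dist_ge0// (le_trans (ler_norm _))//.
  by rewrite lerDl.
lra.
Qed.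

Lemma absr0 : absr (0 : R) = 0. Proof. exact: normr0. Qed.

Lemma BL_bounded_lip g : BL absr g -> exists2 c, 0 < c & bounded_lip c g.
Proof.
move=> /(BL_bound)[c c0 gc]; exists c => //.
by move/(bl_norm_leP absr0 _ (ltW c0)) : gc.
Qed.

Lemma fm_norm_leP m c :
  (fm_norm m <= c%:E)%E <-> forall g, bounded_lip 1 g -> pairing m g <= c.
Proof.
split=> [h g [g1 gl]|h].
  rewrite -lee_fin -charge_integralE; last exact: (@bounded_lip_measurable 1).
  apply: le_trans h; apply: ereal_sup_ubound; exists g => //.
  have g1' : (bl_norm absr g <= 1%:E)%E.
    by apply/(bl_norm_leP absr0 _ ler01).
  split; first exact: le_lt_trans g1' (ltry _).
    exact/sup_norm_leP.
  exact/(lip_const_leP absr0).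
apply: ub_ereal_sup => _ [g [_ /sup_norm_leP g1 /(lip_const_leP absr0 _ ler01) gl] <-].
have gb : bounded_lip 1 g by [].
rewrite charge_integralE ?lee_fin; first exact: h.
exact: bounded_lip_measurable gb.
Qed.

Lemma bounded_lipN c g : bounded_lip c g -> bounded_lip c (fun x => - g x).
Proof.
move=> [gc gl]; split=> [x|x y]; first by rewrite normrN.
by rewrite -opprD normrN.
Qed.

Lemma bounded_lipZ c g (a : R) : 0 <= a -> bounded_lip c g ->
  bounded_lip (a * c) (fun x => a * g x).
Proof.
move=> a0 [gc gl]; split=> [x|x y].
  by rewrite normrM (ger0_norm a0) ler_wpM2l.
by rewrite -mulrBr normrM (ger0_norm a0) -mulrA ler_wpM2l.
Qed.

Lemma pairingZr m g (a : R) : bounded_measurable g ->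
  pairing m (fun x => a * g x) = a * pairing m g.
Proof.
move=> bg; have bag : bounded_measurable (fun x => a * g x).
  case: bg => mg [C gC]; split; first exact: measurable_funM.
  by exists (`|a| * C) => x; rewrite normrM ler_wpM2l.
have fp := @fin_pos_part _ _ _ m; have fn := @fin_neg_part _ _ _ m.
rewrite !pairingE// !RintegralZl//; last 2 first.
- exact: bounded_measurable_integrable.
- exact: bounded_measurable_integrable.
by rewrite mulrBr.
Qed.

Lemma bounded_lipS c c' g : c <= c' -> bounded_lip c g -> bounded_lip c' g.
Proof.
move=> cc' [gc gl]; split=> [x|x y]; first exact: le_trans (gc x) cc'.
by apply: le_trans (gl x y) _; rewrite ler_wpM2r ?dist_ge0.
Qed.

(** The dual norm controls all bounded Lipschitz functions, by scaling them
    into the unit ball. *)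
Lemma pairing_le_fm m g c (r : R) : bounded_lip c g ->
  (fm_norm m <= r%:E)%E -> `|pairing m g| <= c * r.
Proof.
move=> gc /fm_norm_leP mr.
have bg := bounded_lip_measurable gc; have c0 := bounded_lip_ge0 gc.
suff h u : bounded_lip c u -> pairing m u <= c * r.
  rewrite ler_norml h// andbT lerNl.
  rewrite -[leLHS]mulN1r -pairingZr//; apply: h.
  rewrite (_ : (fun _ => _) = (fun x => - g x)); first exact: bounded_lipN.
  by apply/funext => x; rewrite mulN1r.
move=> uc; have bu := bounded_lip_measurable uc.
have [cE0|cN0] := eqVneq c 0.
  rewrite cE0 mul0r (le_trans (ler_norm _))//.
  rewrite (le_trans (pairing_le_tv m bu uc.1))// cE0 mul0r.
  by [].
have c_gt0 : 0 < c by rewrite lt0r cN0.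
rewrite -ler_pdivrMl// -pairingZr//; apply: mr.
rewrite -(mulVf cN0); apply: bounded_lipZ => //.
by rewrite invr_ge0.
Qed.

Lemma fm_norm_le_tv m : (fm_norm m <= (tv m)%:E)%E.
Proof.
apply/fm_norm_leP => g g1; rewrite (le_trans (ler_norm _))//.
rewrite -[leRHS]mul1r pairing_le_tv//; last exact: g1.1.
exact: bounded_lip_measurable g1.
Qed.

Lemma bounded_lip1 : bounded_lip 1 (cst 1 : X -> R).
Proof.
split=> [x|x y] /=; first by rewrite normr1.
by rewrite subrr normr0 mul1r dist_ge0.
Qed.

End fortet_mourier.

(** * Positivity is detected by bounded Lipschitz functions *)

Section lipschitz_cutoff.
Context {R : realType} {d : nat} {k : domain}.
Local Notation X := (Omega R d k).
Implicit Types (U : set X) (x y : X) (c : R).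

Let values U c x : set R :=
  [set r | r = 1 \/ exists2 y, ~ U y & r = Num.min 1 (c * dist x y)].

(** This is min(1, c dist(x, ~U)), written as one infimum so that
    it makes sense when the complement of U is empty. *)
Definition cutoff U c x : R := inf (values U c x).

Let values_ge0 U c x r : 0 <= c -> values U c x r -> 0 <= r.
Proof.
move=> c0 [->//|[y _ ->]].
by rewrite le_min ler01 mulr_ge0// dist_ge0.
Qed.

Let values_inf U c x r : 0 <= c -> values U c x r -> cutoff U c x <= r.
Proof.
by move=> c0 vr; apply: ge_inf => //; exists 0 => s /(values_ge0 c0).
Qed.

Let values_neq0 U c x : values U c x !=set0.
Proof. by exists 1; left. Qed.

Lemma cutoff_itv U c x : 0 <= c -> 0 <= cutoff U c x <= 1.
Proof.
move=> c0; apply/andP; split; last by apply: values_inf => //; left.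
by apply: lb_le_inf => // r /(values_ge0 c0).
Qed.

Lemma cutoff_out U c x : 0 <= c -> ~ U x -> cutoff U c x = 0.
Proof.
move=> c0 Ux; apply/eqP; rewrite eq_le; have /andP[-> _] := cutoff_itv U x c0.
rewrite andbT; apply: values_inf => //; right; exists x => //.
by rewrite distxx mulr0 min_r.
Qed.

Lemma cutoff_deep U c (e : R) x : 0 <= c -> 1 <= c * e ->
  (forall y, dist x y < e -> U y) -> cutoff U c x = 1.
Proof.
move=> c0 ce xU; apply/eqP; rewrite eq_le.
have /andP[_ ->] := cutoff_itv U x c0.
apply: lb_le_inf => // _ [->//|[y Uy ->]].
rewrite le_min lexx /= (le_trans ce)// ler_wpM2l// leNgt.
by apply/negP => /xU.
Qed.

Lemma cutoff_lip U c x y : 0 <= c ->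
  `|cutoff U c x - cutoff U c y| <= c * dist x y.
Proof.
move=> c0; suff h u w : cutoff U c u - cutoff U c w <= c * dist u w.
  by rewrite ler_norml h andbT lerNl opprB dist_sym h.
rewrite lerBlDr -lerBlDl; apply: lb_le_inf => // r [->|[z Uz ->]].
  rewrite lerBlDl (le_trans (_ : _ <= 1))//; first by have /andP[] := cutoff_itv U u c0.
  by rewrite lerDr mulr_ge0// dist_ge0.
rewrite lerBlDl; apply: (@le_trans _ _ (Num.min 1 (c * dist u z))).
  by apply: values_inf => //; right; exists z.
have t : c * dist u z <= c * dist u w + c * dist w z.
  by rewrite -mulrDr ler_wpM2l// dist_triangle.
have uw0 : 0 <= c * dist u w by rewrite mulr_ge0// dist_ge0.
by rewrite addr_minr le_min !ge_min t lerDr uw0 orbT.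
Qed.

Lemma cutoff_bounded_lip U c : 1 <= c -> bounded_lip c (cutoff U c).
Proof.
move=> c1; have c0 : 0 <= c by rewrite (le_trans ler01).
split=> [x|x y]; last exact: cutoff_lip.
have /andP[g0 g1] := cutoff_itv U x c0.
by rewrite ger0_norm// (le_trans g1).
Qed.

End lipschitz_cutoff.

Section approximation.
Context {R : realType} {d : nat} {k : domain}.
Local Notation X := (Omega R d k).
Variable a : {measure set X -> \bar R}.
Hypothesis fa : fin_num_fun a.
Implicit Types (A B : set X) (u g : X -> R).

Let l1 u : R := \int[a]_(x in setT) `|u x|.

Let approximable A := forall e : R, 0 < e -> exists c g,
  [/\ bounded_lip c g, forall x, 0 <= g x <= 1 &
      l1 (fun x => \1_A x - g x) <= e].

Lemma bounded_measurable_norm u : bounded_measurable u ->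
  bounded_measurable (fun x => `|u x|).
Proof.
move=> [mu [C uC]]; split; first exact: measurableT_comp.
by exists C => x; rewrite normr_id.
Qed.

Lemma bounded_measurable_indic A : measurable A ->
  bounded_measurable (\1_A : X -> R).
Proof.
move=> mA; split; first exact: measurable_indic.
by exists 1 => x; rewrite indicE; case: (x \in A); rewrite ?normr1 ?normr0.
Qed.

Let l1_le u w w' : bounded_measurable u -> bounded_measurable w ->
  bounded_measurable w' -> (forall x, `|u x| <= `|w x| + `|w' x|) ->
  l1 u <= l1 w + l1 w'.
Proof.
move=> /bounded_measurable_norm bu /bounded_measurable_norm bw.
move=> /bounded_measurable_norm bw' uww'.
have iu := bounded_measurable_integrable fa bu.
have iw := bounded_measurable_integrable fa bw.
have iw' := bounded_measurable_integrable fa bw'.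
rewrite /l1 -RintegralD//; apply: le_Rintegral => //.
exact: (integrableD measurableT iw iw').
Qed.

Let l1_indic A : measurable A -> l1 (\1_A : X -> R) = fine (a A).
Proof.
move=> mA; rewrite -(setIT A) -integral_indic//; congr fine.
apply: eq_integral => x _; rewrite setIT indicE.
by case: (x \in A); rewrite ?normr1 ?normr0.
Qed.

Let exhaust (F : (set X)^nat) (e : R) : (forall n, measurable (F n)) ->
  {homo F : n m / (n <= m)%N >-> (n <= m)%O} -> 0 < e ->
  exists n, fine (a (\bigcup_n F n `\` F n)) <= e.
Proof.
move=> mF ndF e0.
have mU : measurable (\bigcup_n F n) by exact: bigcup_measurable.
have mG n : measurable (\bigcup_n F n `\` F n) by exact: measurableD.
have cap0 : \bigcap_n (\bigcup_n F n `\` F n) = set0.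
  by rewrite -subset0 => x /= Fx; have [[n _ Fnx] _] := Fx 0%N I; have [_] := Fx n I.
have := @nonincreasing_cvg_mu _ _ _ a (fun n => \bigcup_n F n `\` F n).
rewrite cap0 measure0 => cv.
have {cv} : (a \o (fun n => \bigcup_n F n `\` F n)) x @[x --> \oo] --> 0%E.
  apply: cv => //; first by rewrite ltey_eq fa.
  move=> n m nm; apply/subsetPset => x [Ux Fx]; split => // Fnx; apply: Fx.
  by have /subsetPset := ndF _ _ nm; exact.
move/fine_cvgP => [_ /cvgrPdist_le/(_ _ e0)[n _ /(_ n (leqnn n))]] /=.
by rewrite sub0r normrN => h; exists n; exact: le_trans (ler_norm _) h.
Qed.

(* The error is supported where the cutoff has not yet reached 1; these sets
   decrease to the empty set as the slope grows. *)
Let approx_open A : dist_open A -> approximable A.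
Proof.
move=> oA e e0; have mA := dist_open_measurable oA.
pose c (n : nat) : R := n.+1%:R.
have c1 n : 1 <= c n by rewrite ler1n.
have c0 n : 0 <= c n by [].
have bl n := cutoff_bounded_lip A (c1 n).
pose F n := A `&` [set x | 1 <= cutoff A (c n) x].
have mF n : measurable (F n).
  apply: measurableI => //.
  have [mg _] := bounded_lip_measurable (bl n).
  have := mg measurableT [set` `[1%R, +oo[] (measurable_itv _); rewrite setTI.
  by congr measurable; apply/seteqP; split=> x /=; rewrite in_itv/= andbT.
have UF : \bigcup_n F n = A.
  apply/seteqP; split=> [x [n _ []//]|x Ax].
  have [r r0 rA] := oA _ Ax.
  exists (Num.truncn r^-1) => //; split => //=.
  rewrite (@cutoff_deep _ _ _ _ _ r)// -ler_pdivrMr// mul1r ltW//.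
  exact: truncnS_gt.
have ndF : {homo F : n m / (n <= m)%N >-> (n <= m)%O}.
  move=> n m nm; apply/subsetPset => x [Ax Fx]; split => //=.
  apply: (le_trans Fx); apply: lb_le_inf; first by exists 1; left.
  move=> r [->|[y Ay ->]]; first by have /andP[] := cutoff_itv A x (c0 n).
  apply: (@le_trans _ _ (Num.min 1 (c n * dist x y))).
    apply: ge_inf; last by right; exists y.
    exists 0 => _ [->//|[z _ ->]].
    by rewrite le_min ler01 mulr_ge0// dist_ge0.
  by rewrite le_min !ge_min lexx/= ler_wpM2r ?orbT ?dist_ge0// ler_nat.
have [n] := exhaust mF ndF e0; rewrite UF => aF.
exists (c n), (cutoff A (c n)); split => //; first by move=> x; exact: cutoff_itv.
rewrite (le_trans _ aF)// -l1_indic; last exact: measurableD.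
have bA := bounded_measurable_indic mA.
have bD := bounded_measurable_indic (measurableD mA (mF n)).
have b0 := @bounded_measurable_cst _ X R 0.
rewrite (le_trans (l1_le _ bD b0 _))//.
- exact: bounded_measurableB bA (bounded_lip_measurable (bl n)).
- move=> x; rewrite /= normr0 addr0 !indicE.
  have /andP[g0 g1] := cutoff_itv A x (c0 n).
  have [Ax|Ax] := pselect (A x); last first.
    by rewrite memNset// cutoff_out// subrr normr0.
  rewrite mem_set//.
  have [Fx|Fx] := pselect (F n x).
    have -> : cutoff A (c n) x = 1 by apply/eqP; rewrite eq_le g1 Fx.2.
    by rewrite subrr normr0.
  by rewrite mem_set// normr1 ger0_norm ?subr_ge0// lerBlDr lerDl.
- rewrite /l1; under [X in _ + X]eq_Rintegral do rewrite normr0.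
  by rewrite Rintegral_cst// mul0r addr0.
Qed.

Let approx_setC A : measurable A -> approximable A -> approximable (~` A).
Proof.
move=> mA h e /h[c [g [gl g01 Ag]]]; have c0 := bounded_lip_ge0 gl.
exists (Num.max 1 c), (fun x => 1 - g x); split.
- split=> [x|x y].
    rewrite le_max; apply/orP; left; have /andP[g0 g1] := g01 x.
    by rewrite ger0_norm ?subr_ge0// lerBlDr lerDl.
  rewrite (_ : 1 - g x - (1 - g y) = g y - g x); last by ring.
  rewrite distrC (le_trans (gl.2 x y))//.
  by rewrite ler_wpM2r ?dist_ge0// le_max lexx orbT.
- by move=> x; have /andP[g0 g1] := g01 x; apply/andP; split; lra.
- rewrite (le_trans _ Ag)// /l1 (@eq_Rintegral _ _ _ _ setT (fun x => `|\1_A x - g x|))//.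
  move=> x _; rewrite !indicE in_setC; case: (x \in A) => /=.
    by rewrite sub0r normrN.
  by rewrite opprB addrCA subrr addr0 sub0r normrN.
Qed.

Let approx_setU A B : measurable A -> measurable B ->
  approximable A -> approximable B -> approximable (A `|` B).
Proof.
move=> mA mB hA hB e e0; have e20 : 0 < e / 2 by rewrite divr_gt0.
have [c [g [gl g01 Ag]]] := hA _ e20; have [c' [g' [gl' g01' Bg']]] := hB _ e20.
have bmax : bounded_lip (Num.max c c') (fun x => Num.max (g x) (g' x)).
  have := bounded_lipS (_ : c <= Num.max c c') gl.
  have := bounded_lipS (_ : c' <= Num.max c c') gl'.
  rewrite !le_max !lexx orbT => /(_ isT)[u1 u2] /(_ isT)[w1 w2].
  split=> [x|x y]; first by rewrite /Num.max; case: ifP.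
  have := u2 x y; have := w2 x y; rewrite !ler_norml.
  move: (Num.max c c' * dist x y) => D.
  by move=> /andP[? ?] /andP[? ?]; rewrite /Num.max; do 2 case: ltP => ?;
     apply/andP; split; lra.
exists (Num.max c c'), (fun x => Num.max (g x) (g' x)); split => //.
  move=> x; have /andP[? ?] := g01 x; have /andP[? ?] := g01' x.
  by rewrite /Num.max; case: ifP => _; apply/andP.
rewrite (splitr e) (le_trans _ (lerD Ag Bg'))// l1_le//.
- by apply: bounded_measurableB; [apply: bounded_measurable_indic; exact: measurableU|
     exact: bounded_lip_measurable bmax].
- by apply: bounded_measurableB; [exact: bounded_measurable_indic|
     exact: bounded_lip_measurable gl].
- by apply: bounded_measurableB; [exact: bounded_measurable_indic|
     exact: bounded_lip_measurable gl'].
move=> x; have /andP[? ?] := g01 x; have /andP[? ?] := g01' x.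
rewrite !indicE in_setU; case: (x \in A) (x \in B) => [] [] /=;
  rewrite /Num.max; case: ltP => ?; rewrite ?sub0r ?normrN;
  do ?[rewrite ger0_norm; last lra]; lra.
Qed.

(** The approximable sets contain the open sets, which are stable under
    intersection, and are closed under complements and countable disjoint
    unions; so Dynkin's lemma applies. *)
Lemma approx_measurable A : measurable A -> approximable A.
Proof.
apply: (@dynkin_induction _ X (@dist_open R d k)) => //.
- move=> U W oU oW x [Ux Wx]; have [e e0 eU] := oU _ Ux; have [r r0 rW] := oW _ Wx.
  exists (Num.min e r); first by rewrite lt_min e0.
  by move=> y; rewrite lt_min => /andP[/eU ? /rW ?].
- move=> e e0; exists 1, (cst 1); split; first exact: bounded_lip1.
    by move=> x /=; rewrite ler01 lexx.
  rewrite /l1 (@eq_Rintegral _ _ _ _ setT (cst 0)).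
    by rewrite Rintegral_cst// mul0r ltW.
  by move=> x _; rewrite indicE in_setT subrr normr0.
- move=> F mF _ hF e e0; have e20 : 0 < e / 2 by rewrite divr_gt0.
  pose G n := \big[setU/set0]_(i < n) F i.
  have mG n : measurable (G n) by exact: bigsetU_measurable.
  have hG n : approximable (G n).
    elim: n => [|n IHn].
      by rewrite /G big_ord0; apply: approx_open => x [].
    rewrite /G big_ord_recr/=; apply: approx_setU => //; exact: mG.
  have ndG : {homo G : n m / (n <= m)%N >-> (n <= m)%O}.
    by move=> n m nm; apply/subsetPset; exact: subset_bigsetU.
  have [n aG] := exhaust mG ndG e20.
  have UG : \bigcup_n G n = \bigcup_n F n.
    apply/seteqP; split=> [x [j _]|x [j _ Fx]].
      by rewrite /G -bigcup_mkord => -[i _ Fx]; exists i.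
    by exists j.+1 => //; rewrite /G -bigcup_mkord; exists j => /=.
  rewrite UG in aG.
  have [c [g [gl g01 Gg]]] := hG n _ e20.
  have mU : measurable (\bigcup_n F n) by exact: bigcup_measurable.
  have mD : measurable (\bigcup_n F n `\` G n) by exact: measurableD.
  exists c, g; split => //.
  rewrite (splitr e) (le_trans _ (lerD aG Gg))// -l1_indic// l1_le//.
  + by apply: bounded_measurableB; [exact: bounded_measurable_indic|
       exact: bounded_lip_measurable gl].
  + exact: bounded_measurable_indic.
  + by apply: bounded_measurableB; [exact: bounded_measurable_indic|
       exact: bounded_lip_measurable gl].
  move=> x; have GU : G n `<=` \bigcup_n F n.
    by rewrite -UG; exact: bigcup_sup.
  rewrite !indicE in_setD; have [Gx|Gx] := pselect (G n x).
    by rewrite !(mem_set Gx) (mem_set (GU _ Gx))/= normr0 add0r.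
  rewrite !(memNset Gx) andbT (le_trans (ler_normD _ _))//.
  by rewrite sub0r.
Qed.

End approximation.

Section positivity.
Context {R : realType} {d : nat} {k : domain}.

Lemma positive_of_pairing (m : Mspace R d k) :
  (forall c g, bounded_lip c g -> (forall x, 0 <= g x) -> 0 <= pairing m g) ->
  positive_charge m.
Proof.
move=> h A mA.
have fp := @fin_pos_part _ _ _ m; have fn := @fin_neg_part _ _ _ m.
have bA := @bounded_measurable_indic R d k A mA.
have -> : m A = (pairing m (\1_A))%:E.
  rewrite -charge_integralE// /charge_integral !integral_indic// setIT.
  exact: jordan_partsE.
rewrite lee_fin; apply/ler_addgt0Pr => e e0.
have fa := fin_measure_add fp fn.
have [c [g [gl g01 Ag]]] := approx_measurable fa mA e0.
have bg := bounded_lip_measurable gl; have bAg := bounded_measurableB bA bg.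
have g0 : 0 <= pairing m g by apply: h gl _ => x; have /andP[] := g01 x.
suff : `|pairing m (fun x => \1_A x - g x)| <= e.
  rewrite pairing_subr// ler_norml => /andP[+ _]; lra.
apply: (le_trans _ Ag); rewrite pairingE//.
rewrite Rintegral_measure_add//; last exact: bounded_measurable_norm.
rewrite (le_trans (ler_normB _ _))// lerD//; apply: le_normr_Rintegral => //;
  exact: bounded_measurable_integrable.
Qed.

End positivity.

(** * Induction along an interval and Gronwall estimates *)

Section real_induction.
Context {R : realType}.

(** Continuous induction along [a, b]: the supremum of the initial segment
    where P holds is attained, and cannot lie before b. *)
Lemma real_induction (P : R -> Prop) (a b : R) :
  P a ->
  (forall t, a <= t < b -> P t ->
     exists2 r : R, 0 < r & forall s, t < s < t + r -> s <= b -> P s) ->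
  (forall t, a < t <= b -> (forall s, a <= s < t -> P s) -> P t) ->
  forall t, a <= t <= b -> P t.
Proof.
move=> Pa right left t /andP[at_ tb].
have ab := le_trans at_ tb.
pose S := [set u | a <= u <= b /\ forall s, a <= s <= u -> P s].
have Sa : S a by split=> [|s]; [rewrite lexx|rewrite -eq_le => /eqP <-].
have Sb : has_ubound S by exists b => u [/andP[]].
have ac : a <= sup S by exact: ub_le_sup.
have cb : sup S <= b by apply: ge_sup; [exists a|move=> u [/andP[]]].
have below s : a <= s < sup S -> P s.
  move=> /andP[as_ sc]; have hS : has_sup S by split => //; exists a.
  have s0 : 0 < sup S - s by rewrite subr_gt0.
  have [u [_ Pu]] := sup_adherent s0 hS.
  by rewrite opprB addrCA subrr addr0 => su; apply: Pu; rewrite as_ ltW.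
have Pc : P (sup S).
  have [->//|aNc] := eqVneq (sup S) a.
  by apply: left => //; rewrite lt_neqAle eq_sym aNc ac cb.
have upto s : a <= s <= sup S -> P s.
  by move=> /andP[as_]; rewrite le_eqVlt => /predU1P[->//|sc]; apply: below; rewrite as_.
have [bc|cltb] := leP b (sup S).
  by apply: upto; rewrite at_ (le_trans tb).
have [|r r0 Pr] := right (sup S) _ Pc; first by rewrite ac.
pose u := Num.min b (sup S + r / 2).
suff : S u.
  move/(ub_le_sup Sb); rewrite /u leNgt lt_min cltb /=.
  by rewrite ltrDl divr_gt0.
have cu : sup S <= u by rewrite /u le_min cb lerDl divr_ge0// ltW.
split=> [|s /andP[as_ su]].
  by rewrite (le_trans ac cu) /u ge_min lexx.
have [sc|cs] := leP s (sup S); first by apply: upto; rewrite as_.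
move: su; rewrite /u le_min => /andP[sb sr]; apply: Pr => //.
by rewrite cs (le_lt_trans sr)// ltrD2l; lra.
Qed.

End real_induction.

Section curves.
Context {R : realType} {d : nat}.
Implicit Types (W Z : R -> 'rV[R]_d) (t : R).

Lemma is_derive_coord W (dW : 'rV[R]_d) t i : is_derive t 1 W dW ->
  is_derive t 1 (fun s => W s ord0 i) (dW ord0 i).
Proof.
move=> [ex <-]; apply: DeriveDef; first exact: (derivable_mxP _ _ _).1.
by rewrite derive_mx// mxE.
Qed.

Lemma is_derive_dotv W Z (dW dZ : 'rV[R]_d) t :
  is_derive t 1 W dW -> is_derive t 1 Z dZ ->
  is_derive t 1 (fun s => dotv (W s) (Z s)) (dotv (W t) dZ + dotv dW (Z t)).
Proof.
move=> hW hZ.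
have h i := is_deriveM (is_derive_coord i hW) (is_derive_coord i hZ).
have {h} := is_derive_sum h.
rewrite (_ : \sum_(i < d) _ = fun s => dotv (W s) (Z s)); last first.
  by apply/funext => s; rewrite fct_sumE.
move=> h; apply: is_derive_eq; rewrite /dotv -big_split/=.
by apply: eq_bigr => i _; congr (_ + _); rewrite /GRing.scale/= mulrC.
Qed.

Lemma within_continuous_dotv (A : set R) W Z :
  {within A, continuous W} -> {within A, continuous Z} ->
  {within A, continuous (fun s => dotv (W s) (Z s))}.
Proof.
move=> cW cZ s; apply: cvg_big => [|i _].
  by move=> x; exact: add_continuous.
apply: cvgM.
- exact: (continuous_comp (cW s) (@coord_continuous _ _ _ ord0 i _)).
- exact: (continuous_comp (cZ s) (@coord_continuous _ _ _ ord0 i _)).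
Qed.

(** Gronwall: the derivative of |W|^2 exp(- 2 L t) is nonpositive. *)
Lemma gronwall W (dW : R -> 'rV[R]_d) (L s T : R) :
  {within `[s, T], continuous W} ->
  (forall t, s < t < T -> is_derive t 1 W (dW t)) ->
  (forall t, s < t < T -> enorm (dW t) <= L * enorm (W t)) ->
  s <= T -> enorm (W T) <= expR (L * (T - s)) * enorm (W s).
Proof.
move=> cW hW dWL; rewrite le_eqVlt => /predU1P[<-|sT].
  by rewrite subrr mulr0 expR0 mul1r.
pose E (t : R) := expR (- 2 * L * t).
have hE t : is_derive t 1 E (- 2 * L * E t).
  have h : is_derive t 1 (fun t : R => - 2 * L * t) (- 2 * L).
    by have := is_deriveZ (- 2 * L) (is_derive_id t 1); rewrite /GRing.scale/= mulr1.
  have hc := is_derive1_comp (is_derive_expR (- 2 * L * t)) h.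
  by apply: (@is_derive_eq _ _ _ _ _ _ _ _ hc); rewrite /E mulrC.
pose u t := dotv (W t) (W t) * E t.
pose du t := dotv (W t) (W t) * (- 2 * L * E t) +
  E t * (dotv (W t) (dW t) + dotv (dW t) (W t)).
have hu t : t \in `]s, T[ -> is_derive t 1 u (du t).
  rewrite in_itv/= => /hW hWt; exact: (is_deriveM (is_derive_dotv hWt hWt) (hE t)).
have cu : {within `[s, T], continuous u}.
  have cE : {within `[s, T], continuous E}.
    apply: derivable_within_continuous => t _; exact: (@ex_derive _ _ _ _ _ _ _ (hE t)).
  have cWW := within_continuous_dotv cW cW.
  by move=> t; apply: cvgM; [exact: cWW|exact: cE].
have [c cst uE] := MVT sT hu cu.
have : du c <= 0.
  move: cst; rewrite in_itv/= => cst.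
  have := dWL _ cst; have Wdc := dotv_le (W c) (dW c).
  have E0 : 0 < E c := expR_gt0 _.
  rewrite /du (dotvC (dW c)) -enorm_sqr => dL.
  have {Wdc} : dotv (W c) (dW c) <= L * enorm (W c) ^+ 2.
    by rewrite (le_trans Wdc)// expr2 mulrCA ler_wpM2l// enorm_ge0.
  move: (dotv _ _) (enorm (W c) ^+ 2) => p q h; nra.
rewrite -(ler_pM2r (_ : 0 < T - s)) ?subr_gt0// mul0r -uE.
rewrite /u -!enorm_sqr subr_le0.
rewrite -ler_pdivlMr ?expR_gt0// => h.
rewrite -(@ler_pXn2r _ 2) ?nnegrE ?enorm_ge0 ?mulr_ge0 ?expR_ge0 ?enorm_ge0//.
apply: (le_trans h); rewrite exprMn -expRM_natl -mulrA mulrC -expRB.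
by rewrite (_ : - 2 * L * s - - 2 * L * T = 2 * (L * (T - s)))//; ring.
Qed.

(** A speed bound is integrated in the direction of the displacement. *)
Lemma displacement_le W (dW : R -> 'rV[R]_d) (C s T : R) :
  {within `[s, T], continuous W} ->
  (forall t, s < t < T -> is_derive t 1 W (dW t)) ->
  (forall t, s < t < T -> enorm (dW t) <= C) ->
  s <= T -> enorm (W T - W s) <= C * (T - s).
Proof.
move=> cW hW dWC; rewrite le_eqVlt => /predU1P[<-|sT].
  by rewrite !subrr enorm0 mulr0.
set e := W T - W s.
have hu t : t \in `]s, T[ ->
    is_derive t 1 (fun r => dotv (W r) e) (dotv (dW t) e).
  rewrite in_itv/= => /hW hWt.
  have := is_derive_dotv hWt (is_derive_cst e t 1).
  by rewrite (_ : dotv _ 0 = 0) ?add0r// -(scale0r 0) dotvZr mul0r.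
have cu : {within `[s, T], continuous (fun r => dotv (W r) e)}.
  by apply: within_continuous_dotv => // t; exact: cvg_cst.
have [c cst] := MVT sT hu cu.
rewrite -dotvNl -dotvDl -enorm_sqr => eE.
have [e0|eN0] := eqVneq (enorm e) 0.
  rewrite e0 mulr_ge0 ?subr_ge0 ?(ltW sT)//.
  move: cst; rewrite in_itv/= => /dWC; exact: le_trans (enorm_ge0 _).
have e0 : 0 < enorm e by rewrite lt0r eN0 enorm_ge0.
rewrite -(ler_pM2r e0) -expr2 eE mulrAC ler_wpM2r ?subr_ge0 ?(ltW sT)//.
rewrite (le_trans (dotv_le _ _))// ler_wpM2r ?enorm_ge0//.
by apply: dWC; move: cst; rewrite in_itv.
Qed.

End curves.

(** * The flow of the velocity field *)

Section flow.
Context {R : realType} {d : nat} {k : domain}.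
Local Notation X := (Omega R d k).
Variables (v : R -> X -> 'rV[R]_d) (Phi : R -> R -> X -> X).
Hypotheses (hv : velocity_field v) (hPhi : flow_map v Phi).

Definition velocity_bound (C t : R) :=
  (forall x, enorm (v t x) <= C) /\
  (forall x y, enorm (v t x - v t y) <= C * dist x y).

Let near_bound (t C : R) : 0 <= t -> velocity_bound C t ->
  exists2 r : R, 0 < r &
    forall s, 0 <= s -> `|t - s| < r -> velocity_bound (C + 1) s.
Proof.
move=> t0 [Cv Cl]; have [_ _ /(_ t t0 1 ltr01)[r r0 hr]] := hv.
exists r => // s s0 ts.
have /ltW/(bl_norm_leP (enorm0 : enorm (0 : 'rV[R]_d) = 0) _ ler01)[D1 D2] := hr s s0 ts.
split=> [x|x y].
- have := enormB_triangle (v s x) (v t x) 0; rewrite !subr0 => h.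
  by rewrite (le_trans h)// addrC lerD// enormB_sym.
- rewrite (_ : v s x - v s y =
      (v t x - v t y) - (v t x - v s x - (v t y - v s y))); last first.
    by apply/rowP => i; rewrite !mxE; ring.
  by rewrite (le_trans (enormD _ _))// mulrDl lerD// enormN.
Qed.

Let bound_at (t : R) : 0 <= t -> exists2 C, 0 < C & velocity_bound C t.
Proof.
move=> t0; have [_ /(_ t t0) /(BL_bound)[C C0 hC] _] := hv.
by exists C => //; move/(bl_norm_leP (enorm0 : enorm (0 : 'rV[R]_d) = 0) _ (ltW C0)) : hC.
Qed.

Lemma velocity_boundS (C C' t : R) : C <= C' -> velocity_bound C t ->
  velocity_bound C' t.
Proof.
move=> CC' [Cv Cl]; split=> [x|x y]; first exact: le_trans (Cv x) CC'.
by rewrite (le_trans (Cl x y))// ler_wpM2r// dist_ge0.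
Qed.

(** Continuity of the field with values in the bounded Lipschitz functions
    makes its norm locally bounded in time, hence bounded on [0, T]. *)
Lemma velocity_bounded (T : R) : 0 <= T -> exists2 C : R, 0 < C &
  forall t, 0 <= t <= T -> velocity_bound C t.
Proof.
move=> T0; pose P t := exists2 C : R, 0 < C & forall s, 0 <= s <= t -> velocity_bound C s.
suff : forall t, 0 <= t <= T -> P t by move=> /(_ T); apply; rewrite T0 lexx.
apply: real_induction.
- have [C C0 hC] := bound_at (lexx 0); exists C => // s.
  by rewrite -eq_le => /eqP <-.
- move=> t /andP[t0 tT] [C C0 hC].
  have [|r r0 hr] := @near_bound t C t0; first by apply: hC; rewrite t0 lexx.
  exists r => // s /andP[ts str] sT; exists (C + 1); first by rewrite addr_gt0.
  move=> u /andP[u0 us]; have [ut|tu] := leP u t.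
    by apply: (@velocity_boundS C); [rewrite lerDl|apply: hC; rewrite u0].
  by apply: hr => //; rewrite distrC gtr0_norm ?subr_gt0//; lra.
- move=> t /andP[t0 tT] hP; have [C C0 hC] := bound_at (ltW t0).
  have [r r0 hr] := near_bound (ltW t0) hC.
  pose s := Num.max 0 (t - r / 2).
  have s0 : 0 <= s by rewrite /s le_max lexx.
  have st : s < t by rewrite /s gt_max t0 ltrBlDr ltrDl divr_gt0.
  have sr : t - r / 2 <= s by rewrite /s le_max lexx orbT.
  have [|C' C'0 hC'] := hP s; first by rewrite s0.
  exists (C + 1 + C'); first by rewrite !addr_gt0.
  move=> u /andP[u0 ut]; have [us|su] := leP u s.
    apply: (@velocity_boundS C'); first by rewrite lerDr addr_ge0// ltW.
    by apply: hC'; rewrite u0.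
  apply: (@velocity_boundS (C + 1)); first by rewrite lerDl ltW.
  by apply: hr => //; rewrite ger0_norm ?subr_ge0//; lra.
Qed.

Definition lifts_solution (s : R) (x : R -> X) (Y : R -> 'rV[R]_d) :=
  [/\ forall t, s <= t -> x t = proj k (Y t),
      {within `[s, +oo[, continuous Y} &
      forall t : R, s < t -> is_derive t 1 Y (v t (x t))].

Lemma lifts_solutionS (s t : R) x Y : s <= t -> lifts_solution s x Y ->
  lifts_solution t x Y.
Proof.
move=> st [xY cY dY]; split=> [r tr||r tr].
- by apply: xY; exact: le_trans tr.
- apply: continuous_subspaceW cY => r /=; rewrite !in_itv/= !andbT.
  exact: le_trans.
- by apply: dY; exact: le_lt_trans tr.
Qed.

Let within_seg (s T : R) (W : R -> 'rV[R]_d) :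
  {within `[s, +oo[, continuous W} -> {within `[s, T], continuous W}.
Proof.
apply: continuous_subspaceW => r /=; rewrite !in_itv/= andbT.
by move=> /andP[].
Qed.

(** A lift may be translated by the difference of two lifts of its starting
    point, so the compared lifts can be made to start at prescribed points;
    their difference then satisfies a linear differential inequality. *)
Lemma lift_gronwall (C s T : R) x y Y Z (a b : 'rV[R]_d) : 0 <= s -> s <= T ->
  (forall t, 0 <= t <= T -> velocity_bound C t) ->
  lifts_solution s x Y -> lifts_solution s y Z ->
  proj k a = x s -> proj k b = y s ->
  exists a' b', [/\ proj k a' = x T, proj k b' = y T &
    enorm (a' - b') <= expR (C * (T - s)) * enorm (a - b)].
Proof.
move=> s0 sT hC [xY cY dY] [yZ cZ dZ] ax by_.
pose Y' t := Y t + (a - Y s); pose Z' t := Z t + (b - Z s).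
have pY t : s <= t -> proj k (Y' t) = x t.
  move=> st; rewrite xY//.
  have := proj_addr (Y t - Y s) (etrans ax (xY s (lexx s))).
  by rewrite [Y s + _]addrCA subrr addr0 addrCA.
have pZ t : s <= t -> proj k (Z' t) = y t.
  move=> st; rewrite yZ//.
  have := proj_addr (Z t - Z s) (etrans by_ (yZ s (lexx s))).
  by rewrite [Z s + _]addrCA subrr addr0 addrCA.
exists (Y' T), (Z' T); split; [exact: pY|exact: pZ|].
pose W t := Y' t - Z' t.
have WE : W = (Y - Z) + cst ((a - Y s) - (b - Z s)).
  by apply/funext => t; rewrite /W /Y' /Z' /= opprD addrACA.
have Ws : W s = a - b.
  by rewrite /W /Y' /Z' [Y s + _]addrC [Z s + _]addrC !subrK.
rewrite -Ws -/(W T); apply: (@gronwall _ _ W (fun t => v t (x t) - v t (y t))) => //.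
- rewrite WE; apply: within_continuousD; last by move=> t; exact: cvg_cst.
  by apply: within_continuousB; exact: within_seg.
- move=> t /andP[st _]; rewrite WE.
  have h := is_deriveD (is_deriveB (dY t st) (dZ t st))
    (is_derive_cst ((a - Y s) - (b - Z s)) t 1).
  by apply: (@is_derive_eq _ _ _ _ _ _ _ _ h); rewrite addr0.
- move=> t /andP[st tT].
  have t0T : 0 <= t <= T by rewrite (le_trans s0 (ltW st)) ltW.
  have [bv bl] := hC _ t0T; rewrite (le_trans (bl _ _))// ler_wpM2l//.
    exact: le_trans (enorm_ge0 _) (bv (x t)).
  by rewrite -(pY t (ltW st)) -(pZ t (ltW st)) dist_le_enorm.
Qed.

Let flow_lift (s : R) x0 : 0 <= s -> exists Y,
  lifts_solution s (fun t => Phi s t x0) Y.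
Proof. by move=> s0; have [_ [Y hY]] := hPhi s0 x0; exists Y. Qed.

Lemma flow_id (s : R) x : 0 <= s -> Phi s s x = x.
Proof. by move=> s0; have [] := hPhi s0 x. Qed.

Lemma flow_lip (C s t T : R) x y : 0 <= s -> s <= t -> t <= T ->
  (forall t, 0 <= t <= T -> velocity_bound C t) ->
  dist (Phi s t x) (Phi s t y) <= expR (C * (t - s)) * dist x y.
Proof.
move=> s0 st tT hC; have [Y hY] := flow_lift x s0; have [Z hZ] := flow_lift y s0.
rewrite -ler_pdivrMl ?expR_gt0//; apply: le_distP => a b ax by_.
rewrite ler_pdivrMl ?expR_gt0//.
have hCt u : 0 <= u <= t -> velocity_bound C u.
  by move=> /andP[u0 ut]; apply: hC; rewrite u0 (le_trans ut).
have axs : proj k a = Phi s s x by rewrite flow_id.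
have bys : proj k b = Phi s s y by rewrite flow_id.
have [a' [b' [<- <-]]] := lift_gronwall s0 st hCt hY hZ axs bys.
exact: le_trans (dist_le_enorm _ _).
Qed.

(** Uniqueness of solutions: both curves start at time t from the same lift,
    so Gronwall's inequality leaves no gap between them. *)
Lemma flow_comp (s t r : R) x : 0 <= s -> s <= t -> t <= r ->
  Phi t r (Phi s t x) = Phi s r x.
Proof.
move=> s0 st tr; have t0 := le_trans s0 st.
have [C C0 hC] := velocity_bounded (le_trans t0 tr).
have [Y /(lifts_solutionS st) hY] := flow_lift x s0.
have [Z hZ] := flow_lift (Phi s t x) t0.
have [a ax] := proj_surj (Phi s t x).
have axt : proj k a = Phi t t (Phi s t x) by rewrite flow_id.
have [a' [b' [<- <-]]] := lift_gronwall t0 tr hC hY hZ ax axt.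
rewrite subrr enorm0 mulr0 => h; congr proj; apply/esym/eqP.
by rewrite -subr_eq0; apply/eqP/enorm0_eq0/eqP; rewrite eq_le h enorm_ge0.
Qed.

Lemma flow_speed (C s t T : R) x : 0 <= s -> s <= t -> t <= T ->
  (forall t, 0 <= t <= T -> velocity_bound C t) ->
  dist (Phi s t x) x <= C * (t - s).
Proof.
move=> s0 st tT hC; have [Y [xY cY dY]] := flow_lift x s0.
rewrite -[X in dist _ X](flow_id x s0) !xY//.
apply: (le_trans (dist_le_enorm _ _)).
apply: (@displacement_le _ _ Y (fun r => v r (Phi s r x))) => //.
- exact: within_seg.
- by move=> r /andP[sr _]; exact: dY.
- move=> r /andP[sr rt]; apply: (hC _ _).1.
  by rewrite (le_trans s0 (ltW sr)) (le_trans (ltW rt)).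
Qed.

Lemma flow_measurable (s t : R) : 0 <= s -> s <= t ->
  measurable_fun setT (Phi s t).
Proof.
move=> s0 st; have [C C0 hC] := velocity_bounded (le_trans s0 st).
apply: (@lip_measurable _ _ _ _ (expR (C * (t - s)))) => x y.
exact: flow_lip hC.
Qed.

End flow.

(** * Testing elements of the completion against Lipschitz functions *)

Section completion.
Context {R : realType} {d : nat} {k : domain}.
Local Notation X := (Omega R d k).
Local Notation M := (Mspace R d k).
Variables (B : completeNormedModType R) (iota : M -> B).
Hypothesis hB : is_fm_completion iota.
Implicit Types (m : M) (b : B) (g : X -> R).

Let iota_lin (a : R) m m' : iota (cadd (cscale a m) m') = a *: iota m + iota m'.
Proof. by have [] := hB. Qed.

Let iota_norm m : `|iota m|%:E = fm_norm m.
Proof. by have [] := hB. Qed.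

Let iota_approx b (e : R) : 0 < e -> exists m, `|b - iota m| < e.
Proof.
move=> e0; have [_ _ /(_ (ball b e))] := hB.
case; [by exists b; exact: ballxx|exact: ball_open|].
by move=> x [+ [m _ mx]]; rewrite -mx -ball_normE => bm; exists m.
Qed.

Lemma eq_iota m m' : (forall A, measurable A -> m A = m' A) -> iota m = iota m'.
Proof.
move=> mm'; apply/eqP; rewrite -subr_eq0 -normr_le0 -lee_fin distrC.
rewrite addrC -scaleN1r -iota_lin iota_norm.
apply/fm_norm_leP => g /bounded_lip_measurable bg.
by rewrite pairing_cadd// pairing_cscale// (eq_pairing mm' bg) mulN1r addNr.
Qed.

Lemma iota_czero : iota czero = 0.
Proof.
apply/eqP; rewrite -normr_le0 -lee_fin iota_norm.
apply/fm_norm_leP => g /bounded_lip_measurable bg.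
suff -> : pairing (czero : M) g = 0 by [].
have := pairing_cscale 0 (czero : M) bg; rewrite mul0r => <-.
by apply: eq_pairing => // A mA /=; rewrite /cscale mul0e.
Qed.

Lemma fm_distE m m' : fm_dist m m' = `|iota m - iota m'|%:E.
Proof.
rewrite /fm_dist -iota_norm; congr (`| _ |%:E).
rewrite (addrC (iota m)) -scaleN1r -iota_lin; apply: eq_iota => A mA.
transitivity (m A - m' A)%E; first by [].
transitivity (cscale (-1) m' A + m A)%E; last by [].
by rewrite cscaleN1 addeC.
Qed.

Lemma pairing_iota (c : R) g m m' : bounded_lip c g ->
  `|pairing m g - pairing m' g| <= c * `|iota m - iota m'|.
Proof.
move=> gc; have bg := bounded_lip_measurable gc.
by rewrite -pairing_sub//; apply: pairing_le_fm => //; rewrite -fm_distE.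
Qed.

(** Integration of g is c-Lipschitz on the dense subspace of measures, so it
    has exactly one c-Lipschitz extension, written below as a supremum of
    cones; linearity follows by approximation. *)
Lemma pairing_extension (c : R) g : bounded_lip c g -> exists L : B -> R,
  [/\ forall m, L (iota m) = pairing m g,
      forall (a : R) b b', L (a *: b + b') = a * L b + L b' &
      forall b, `|L b| <= c * `|b|].
Proof.
move=> gc; have bg := bounded_lip_measurable gc; have c0 := bounded_lip_ge0 gc.
pose S b := [set pairing m g - c * `|b - iota m| | m in [set: M]].
have ubS b m : ubound (S b) (pairing m g + c * `|b - iota m|).
  move=> _ [m' _ <-]; rewrite lerBlDr -addrA -lerBlDl.
  apply: (le_trans (ler_norm _)); apply: (le_trans (pairing_iota _ _ gc)).
  by rewrite -mulrDr ler_wpM2l// [leRHS]addrC (distrC b (iota m')) ler_distD.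
have S0 b : S b !=set0 by exists (pairing (czero : M) g - c * `|b - iota czero|), czero.
exists (fun b => sup (S b)).
have key b m : `|sup (S b) - pairing m g| <= c * `|b - iota m|.
  rewrite ler_norml; apply/andP; split.
    rewrite lerBrDl; apply: ub_le_sup; last by exists m.
    by exists (pairing m g + c * `|b - iota m|).
  by rewrite lerBlDl; apply: ge_sup.
split=> [m|a b b'|b].
- apply/eqP; rewrite -subr_eq0 -normr_le0.
  by rewrite (le_trans (key _ m))// subrr normr0 mulr0.
- apply/eqP; rewrite -subr_eq0 -normr_le0; apply/ler_addgt0Pr => e e0; rewrite add0r.
  (* Four error terms, each at most (c + 1) (|a| + 1) times the mesh e / K. *)
  pose K := (c + 1) * (`|a| + 1) * 4.
  have K0 : 0 < K by rewrite !mulr_gt0// ltr_wpDl.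
  have [m bm] := iota_approx b (divr_gt0 e0 K0).
  have [m' bm'] := iota_approx b' (divr_gt0 e0 K0).
  have := key (a *: b + b') (cadd (cscale a m) m').
  rewrite iota_lin pairing_cadd// pairing_cscale//.
  have -> : a *: b + b' - (a *: iota m + iota m') = a *: (b - iota m) + (b' - iota m').
    by rewrite scalerBr opprD addrACA.
  move=> h1; have h2 := key b m; have h3 := key b' m'.
  have {}h1 := le_trans h1 (ler_wpM2l c0 (ler_normD _ _)).
  rewrite normrZ in h1.
  rewrite (_ : _ - _ = (sup (S (a *: b + b')) - (a * pairing m g + pairing m' g))
      - (a * (sup (S b) - pairing m g) + (sup (S b') - pairing m' g))); last by ring.
  apply: (le_trans (ler_normB _ _)).
  apply: (le_trans (lerD h1 (ler_normD _ _))).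
  have h2' := ler_wpM2l (normr_ge0 a) h2.
  set q := e / K in bm bm'.
  have eE : e = (c + 1) * (`|a| + 1) * 4 * q.
    by rewrite /q -/K mulrC divfK// gt_eqF.
  have q0 : 0 < q by rewrite divr_gt0.
  rewrite [`|a * _|]normrM.
  move: (normr_ge0 a) (normr_ge0 (b - iota m)) (normr_ge0 (b' - iota m')) h2' h3 bm bm'.
  rewrite eE; move: `|a| `|b - iota m| `|b' - iota m'|
    `|sup (S b) - _| `|sup (S b') - _| => A x y z w.
  move=> A0 x0 y0 h2' h3 xq yq.
  have Ax : A * x <= A * q by rewrite ler_wpM2l// ltW.
  have cx : c * (A * x) <= c * (A * q) by rewrite ler_wpM2l.
  have cy : c * y <= c * q by rewrite ler_wpM2l// ltW.
  have cAx : A * (c * x) = c * (A * x) by ring.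
  have Aq : 0 <= A * q by rewrite mulr_ge0// ltW.
  have cAq : 0 <= c * (A * q) by rewrite mulr_ge0.
  have cq : 0 <= c * q by rewrite mulr_ge0// ltW.
  have -> : (c + 1) * (A + 1) * 4 * q =
      4 * (c * (A * q)) + 4 * (c * q) + 4 * (A * q) + 4 * q by ring.
  rewrite mulrDr; lra.
- have := key b czero; rewrite iota_czero subr0.
  have -> : pairing (czero : M) g = 0; last by rewrite subr0.
  have := pairing_cscale 0 (czero : M) bg; rewrite mul0r => <-.
  by apply: eq_pairing => // A mA /=; rewrite /cscale mul0e.
Qed.

End completion.

Section bochner_scalar.
Context {dsp : measure_display} {T : measurableType dsp} {R : realType}.
Context {B : completeNormedModType R}.
Variables (m : {measure set T -> \bar R}) (D : set T).
Hypotheses (mD : measurable D) (mDoo : (m D < +oo)%E).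

(** The integral of a nonnegative function is a supremum over the simple
    functions below it, hence monotone without measurability.  This matters
    because the definition of the Bochner integral says nothing about the
    measurability of the norm of h - s_n. *)
Lemma le_nonneg_integral (f1 f2 : T -> \bar R) :
  (forall x, D x -> (0 <= f1 x <= f2 x)%E) ->
  (\int[m]_(x in D) f1 x <= \int[m]_(x in D) f2 x)%E.
Proof.
move=> f12; rewrite !(integral_mkcond D).
have f10 x : (0 <= (f1 \_ D) x)%E.
  by rewrite patchE; case: ifPn => //; rewrite inE => /f12/andP[].
have f12' x : ((f1 \_ D) x <= (f2 \_ D) x)%E.
  by rewrite !patchE; case: ifPn => //; rewrite inE => /f12/andP[].
rewrite !ge0_integralTE//; last by move=> x; exact: le_trans (f10 x) (f12' x).
by apply: ereal_sup_le => _ [h hf <-]; exists h => // x; exact: le_trans (hf x) (f12' x).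
Qed.

Variables (L : B -> R) (c : R).
Hypothesis L_lin : forall (a : R) b b', L (a *: b + b') = a * L b + L b'.
Hypothesis L_bound : forall b, `|L b| <= c * `|b|.

Let L0 : L 0 = 0.
Proof. by have := L_lin 1 0 0; rewrite scale1r addr0; lra. Qed.

Let LB b b' : L b - L b' = L (b - b').
Proof. by rewrite addrC -mulN1r -L_lin scaleN1r addrC. Qed.

Let L_sum (I : Type) (r : seq I) (a : I -> R) (F : I -> B) :
  L (\sum_(i <- r) a i *: F i) = \sum_(i <- r) a i * L (F i).
Proof. by elim/big_rec2: _ => [|i x b _ IH]; rewrite ?L0// L_lin IH. Qed.

Let mfinI (A : set T) : measurable A -> (m (D `&` A) < +oo)%E.
Proof.
move=> mA; apply: le_lt_trans mDoo; apply: le_measure; rewrite ?inE//.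
exact: measurableI.
Qed.

Let simple_integral (s : T -> B) : bochner_simple s ->
  m.-integrable D (EFin \o (L \o s)) /\
  \int[m]_(x in D) L (s x) = L (bochner_sintegral m D s).
Proof.
move=> [fs ms]; pose r := finmap.enum_fset (fset_set (range s)).
have sE x : (L (s x))%:E = (\sum_(y <- r) (L y * \1_(s @^-1` [set y]) x)%:E)%E.
  rewrite sumEFin; congr (_%:E).
  have sr : s x \in r by have := in_fset_set fs (s x); rewrite mem_set//; exists x.
  rewrite (bigD1_seq (s x))//=; last exact: finmap.fset_uniq.
  rewrite indicE mem_set// mulr1 big1 ?addr0// => y ysx.
  by rewrite indicE memNset ?mulr0// => /= sy; rewrite sy eqxx in ysx.
have i1 y : m.-integrable D (fun x => (\1_(s @^-1` [set y]) x)%:E).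
  apply: measurable_bounded_integrable => //.
  exists 1; split; first exact: num_real.
  move=> M M1 x _ /=; rewrite indicE.
  by case: (_ \in _); rewrite ?normr1 ?normr0 ltW// (lt_trans ltr01).
have iy y : m.-integrable D (fun x => (L y * \1_(s @^-1` [set y]) x)%:E).
  have -> : (fun x => (L y * \1_(s @^-1` [set y]) x)%:E) =
      (fun x => (L y)%:E * (\1_(s @^-1` [set y]) x)%:E)%E.
    by apply/funext => x; rewrite EFinM.
  exact: integrableZl.
have iE : EFin \o (L \o s) = fun x => (\sum_(y <- r) (L y * \1_(s @^-1` [set y]) x)%:E)%E.
  by apply/funext => x; rewrite /= sE.
split; first by rewrite iE; apply: integrable_sum.
rewrite /Rintegral; under eq_integral do rewrite sE.
rewrite integral_sum// /bochner_sintegral.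
rewrite -(fsbig_widen (range s)) //; last first.
  move=> y [_ ys] /=; rewrite (_ : D `&` _ = set0) ?measure0 ?scale0r//.
  by rewrite -subset0 => x [_ sx]; apply: ys; exists x.
rewrite fsbig_finite// L_sum.
have -> : (\sum_(y <- r) \int[m]_(x in D) (L y * \1_(s @^-1` [set y]) x)%:E =
   \sum_(y <- r) (fine (m (D `&` s @^-1` [set y])) * L y)%:E)%E.
  apply: eq_bigr => y _; under eq_integral do rewrite EFinM.
  rewrite integralZl//.
  rewrite integral_indic// setIC EFinM fineK 1?muleC// ge0_fin_numE//.
  exact: mfinI.
by rewrite sumEFin.
Qed.

(** Both sides are limits along the approximating simple functions, on which
    they agree by linearity. *)
Lemma bochner_integral_functional (h : T -> B) (I : B) :
  bochner_integral_is m D h I -> m.-integrable D (EFin \o (L \o h)) ->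
  L I = \int[m]_(x in D) L (h x).
Proof.
move=> [s [ss _ hs sI]] ih.
have c0 : 0 < `|c| + 1 by rewrite ltr_wpDl.
have bound b : `|L b| <= (`|c| + 1) * `|b|.
  rewrite (le_trans (L_bound b))// ler_wpM2r// (le_trans (ler_norm _))//.
  by rewrite lerDl.
apply/eqP; rewrite -subr_eq0 -normr_le0; apply/ler_addgt0Pr => e e0; rewrite add0r.
have e1 : 0 < e / (2 * (`|c| + 1)) by rewrite divr_gt0// mulr_gt0.
move/cvgrPdist_lt : sI => /(_ _ e1)[n1 _ h1].
move/fine_cvgP : hs => [[n2 _ h2] /cvgrPdist_lt/(_ _ e1)[n3 _ h3]].
pose n := maxn n1 (maxn n2 n3).
have {h1} := h1 n (leq_maxl _ _).
have {h2} := h2 n (leq_trans (leq_maxl _ _) (leq_maxr _ _)).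
have {h3} := h3 n (leq_trans (leq_maxr _ _) (leq_maxr _ _)).
rewrite /= sub0r normrN => h3 h2 h1.
have [is_ sE] := simple_integral (ss n).
have -> : L I - \int[m]_(x in D) L (h x) = L (I - bochner_sintegral m D (s n)) -
    \int[m]_(x in D) (L (h x) - L (s n x)).
  by rewrite RintegralB// sE -LB; ring.
apply: (le_trans (ler_normB _ _)).
rewrite (splitr e) lerD//.
  apply: (le_trans (bound _)); rewrite mulrC -ler_pdivlMr//.
  by rewrite -mulrA -invfM; exact: ltW.
have iD : m.-integrable D (EFin \o (fun x => L (h x) - L (s n x))).
  exact: (integrableB mD ih is_).
apply: (le_trans (le_normr_Rintegral mD iD)).
have c'0 : 0 < (`|c| + 1)^-1 by rewrite invr_gt0.
rewrite -(ler_pM2l c'0) -RintegralZl//; last exact: integrable_norm iD.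
have -> : (`|c| + 1)^-1 * (e / 2) = e / (2 * (`|c| + 1)).
  by rewrite mulrC -mulrA -invfM.
apply: (le_trans _ (ltW h3)); apply: (le_trans _ (ler_norm _)).
rewrite /Rintegral fine_le//.
- exact: (integrable_fin_num mD (integrableZl mD _ (integrable_norm iD))).
- apply: le_nonneg_integral => x Dx; rewrite !lee_fin mulr_ge0 ?invr_ge0 ?(ltW c0)//=.
  by rewrite ler_pdivrMl// LB.
Qed.

End bochner_scalar.

(** * Mild solutions tested against Lipschitz functions *)

Lemma within_continuous_eps {R : realType} (a b : R) (u : R -> R) :
  (forall s, a <= s <= b -> forall e : R, 0 < e -> exists2 r : R, 0 < r &
     forall s', a <= s' <= b -> `|s - s'| < r -> `|u s - u s'| < e) ->
  {within `[a, b], continuous u}.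
Proof.
move=> h; apply/subspace_continuousP => s; rewrite /= in_itv/= => sab.
apply/cvgrPdist_lt => e e0; have [r r0 hr] := h s sab e e0.
exists r => //= s' ss'; rewrite in_itv/= => s'ab; exact: hr.
Qed.

Section mild.
Context {R : realType} {d : nat} {k : domain}.
Local Notation X := (Omega R d k).
Local Notation M := (Mspace R d k).
Variables (v : R -> X -> 'rV[R]_d) (Phi : R -> R -> X -> X) (f : R -> M -> M).
Variables (B : completeNormedModType R) (iota : M -> B).
Variables (t0 T : R) (nu : M) (mu : R -> M) (C : R).
Hypotheses (hv : velocity_field v) (hPhi : flow_map v Phi).
Hypothesis hf : reaction_map f.
Hypothesis hB : is_fm_completion iota.
Hypotheses (t0_ge0 : 0 <= t0) (C0 : 0 <= C).
Hypothesis hC : forall t, 0 <= t <= T -> velocity_bound v C t.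
Hypothesis hmu : mild_solution Phi f iota t0 nu T mu.
Implicit Types (g : X -> R) (s t r : R).

Lemma flow_bounded_lip c g s t : bounded_lip c g -> 0 <= s -> s <= t -> t <= T ->
  bounded_lip (expR (C * (t - s)) * c) (g \o Phi s t).
Proof.
move=> gc s0 st tT; have c0 := bounded_lip_ge0 gc; case: gc => gc gl.
split=> [x|x y] /=.
  rewrite (le_trans (gc _))// ler_peMl// -expR0 ler_expR.
  by rewrite mulr_ge0// subr_ge0.
rewrite (le_trans (gl _ _))// [_ * c]mulrC -mulrA ler_wpM2l//.
exact: (flow_lip hPhi _ _ s0 st tT hC).
Qed.

Let E := expR (C * T).

Let expR_le_E s t : 0 <= s -> t <= T -> expR (C * (t - s)) <= E.
Proof. by move=> s0 tT; rewrite ler_expR ler_wpM2l//; lra. Qed.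

Let E0 : 0 < E := expR_gt0 _.

(** Starting later replaces x by a point within C |s - s'| of it, and the
    flow expands this gap by at most the factor E. *)
Lemma flow_start_lip s s' t x : 0 <= s -> 0 <= s' -> s <= t -> s' <= t ->
  t <= T -> dist (Phi s t x) (Phi s' t x) <= E * C * `|s - s'|.
Proof.
wlog ss' : s s' / s <= s'.
  move=> h; have [|/ltW] := leP s s'; first exact: h.
  by rewrite dist_sym distrC => ss' s0 s'0 st s't; exact: h.
move=> s0 s'0 st s't tT.
rewrite -(flow_comp hv hPhi x s0 ss' s't).
apply: (le_trans (flow_lip hPhi _ _ s'0 s't tT hC)).
rewrite distrC ger0_norm ?subr_ge0// -mulrA ler_pM ?expR_ge0 ?dist_ge0//.
  exact: expR_le_E.
exact: (flow_speed hPhi _ s0 ss' (le_trans s't tT) hC).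
Qed.

Lemma pairing_flow_lip c g s s' t m m' : bounded_lip c g ->
  0 <= s -> 0 <= s' -> s <= t -> s' <= t -> t <= T ->
  `|pairing m (g \o Phi s t) - pairing m' (g \o Phi s' t)| <=
  c * E * (`|iota m - iota m'| + C * `|s - s'| * tv m).
Proof.
move=> gc s0 s'0 st s't tT; have c0 := bounded_lip_ge0 gc.
have gs := flow_bounded_lip gc s0 st tT; have gs' := flow_bounded_lip gc s'0 s't tT.
have bs := bounded_lip_measurable gs; have bs' := bounded_lip_measurable gs'.
rewrite -(subrKA (pairing m (g \o Phi s' t))) addrC mulrDr.
rewrite (le_trans (ler_normD _ _))// lerD//.
  apply: (le_trans (pairing_iota hB _ _ gs')).
  by rewrite ler_wpM2r// mulrC ler_wpM2l// expR_le_E.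
rewrite -pairing_subr//.
have -> : c * E * (C * `|s - s'| * tv m) = c * (E * C * `|s - s'|) * tv m by ring.
apply: pairing_le_tv; first exact: bounded_measurableB.
move=> x; apply: (le_trans (gc.2 _ _)); rewrite ler_wpM2l//.
exact: flow_start_lip.
Qed.

Lemma reaction_continuous s : t0 <= s <= T -> forall e : R, 0 < e ->
  exists2 r : R, 0 < r & forall s', t0 <= s' <= T -> `|s - s'| < r ->
    `|iota (f s (mu s)) - iota (f s' (mu s'))| < e.
Proof.
move=> sT e e0; have [cmu _ _] := hmu; have [cf _ _] := hf.
have s0 : 0 <= s by move: sT => /andP[+ _]; exact: le_trans.
have [r r0 hr] := cf (s, mu s) s0 e e0.
have sI : `[t0, T]%classic s by rewrite /= in_itv.
have [r' r'0 hr'] := cmu s sI r r0.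
exists (Num.min r r'); first by rewrite lt_min r0.
move=> s' s'T; rewrite lt_min => /andP[ssr ssr'].
have s'0 : 0 <= s' by move: s'T => /andP[+ _]; exact: le_trans.
have s'I : `[t0, T]%classic s' by rewrite /= in_itv.
rewrite -lte_fin -(fm_distE hB); apply: (hr (s', mu s')) => //.
by rewrite /prod_dist /= gt_max /real_dist lte_fin ssr hr'// lte_fin.
Qed.

Let integrand g t s := pairing (f s (mu s)) (g \o Phi s t).

(** The radius does not depend on the test function or on the final time:
    this uniformity makes the Euler expansion an estimate in norm. *)
Lemma integrand_near c s e : 0 <= c -> t0 <= s <= T -> 0 < e ->
  exists2 r : R, 0 < r & forall g s' t, bounded_lip c g ->
    t0 <= s' <= t -> s <= t -> t <= T -> `|s - s'| < r ->
    `|integrand g t s - integrand g t s'| < e.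
Proof.
move=> c0 /andP[ts sT] e0; have s0 := le_trans t0_ge0 ts.
(* Half of e / K goes to the variation of f, half to that of the flow. *)
pose K := c * E + 1; have K0 : 0 < K by rewrite ltr_wpDl// mulr_ge0// ltW.
have e1 : 0 < e / K / 2 by rewrite !divr_gt0.
have [|r r0 hr] := @reaction_continuous s _ _ e1; first by rewrite ts.
set V := tv (f s (mu s)); have V0 : 0 <= V := tv_ge0 _.
have V1 : 0 < C * V + 1 by rewrite ltr_wpDl// mulr_ge0.
exists (Num.min r (e / K / 2 / (C * V + 1))).
  by rewrite lt_min r0 divr_gt0.
move=> g s' t gc /andP[ts' st'] st tT; rewrite lt_min => /andP[ssr].
rewrite ltr_pdivlMr// => ss.
apply: (le_lt_trans (pairing_flow_lip _ _ gc s0 (le_trans t0_ge0 ts') st st' tT)).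
have {}hr : `|iota (f s (mu s)) - iota (f s' (mu s'))| < e / K / 2.
  by apply: hr => //; rewrite ts' (le_trans st').
have hV : C * `|s - s'| * V <= `|s - s'| * (C * V + 1).
  by rewrite mulrDr mulr1 mulrAC mulrC lerDl.
apply: (@le_lt_trans _ _
    (K * (`|iota (f s (mu s)) - iota (f s' (mu s'))| + C * `|s - s'| * V))).
  by rewrite ler_wpM2r ?addr_ge0 ?mulr_ge0// lerDl.
rewrite mulrC -ltr_pdivlMr// [ltRHS]splitr ltrD//.
exact: le_lt_trans ss.
Qed.

Lemma integrand_integrable c g t : bounded_lip c g -> t0 <= t <= T ->
  lebesgue_measure.-integrable `[t0, t] (EFin \o integrand g t).
Proof.
move=> gc /andP[tt tT]; have c0 := bounded_lip_ge0 gc.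
apply: continuous_compact_integrable; first exact: segment_compact.
apply: within_continuous_eps => s /andP[ts st] e e0.
have [|r r0 hr] := @integrand_near c s e c0 _ e0; first by rewrite ts (le_trans st).
by exists r => // s' s'tt; exact: hr.
Qed.

Lemma mild_pairing c g t : bounded_lip c g -> t0 <= t <= T ->
  pairing (mu t) g = pairing nu (g \o Phi t0 t) +
    \int[lebesgue_measure]_(s in `[t0, t]) integrand g t s.
Proof.
move=> gc tT; have bg := bounded_lip_measurable gc.
have [_ _ /(_ t tT)[I hI muE]] := hmu.
have [L [Liota L_lin L_bound]] := pairing_extension hB gc.
move: tT => /andP[tt tT].
have pushE s m : t0 <= s <= t -> L (iota (push (Phi s t) m)) = pairing m (g \o Phi s t).
  move=> /andP[ts st]; rewrite Liota pairing_push//.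
  exact: flow_measurable hv hPhi _ _ (le_trans t0_ge0 ts) st.
rewrite -Liota muE -[iota (push _ _)]scale1r L_lin mul1r pushE ?lexx//.
congr (_ + _).
have DE : {in `[t0, t]%classic,
    L \o (fun s => iota (push (Phi s t) (f s (mu s)))) =1 integrand g t}.
  by move=> s; rewrite inE/= in_itv/= => /pushE ->.
rewrite (bochner_integral_functional _ _ L_lin L_bound hI)//.
- exact: eq_Rintegral.
- by rewrite /= lebesgue_measure_itv/=; case: ifP => _; rewrite -?EFinD ltry.
- have := integrand_integrable gc (_ : t0 <= t <= T); rewrite tt => /(_ tT).
  by apply: eq_integrable => // s /DE /= ->.
Qed.

(** Evolution from an intermediate time; this is where the flow property of
    Phi enters. *)
Lemma duhamel c g t r : bounded_lip c g -> t0 <= t -> t <= r -> r <= T ->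
  pairing (mu r) g = pairing (mu t) (g \o Phi t r) +
    \int[lebesgue_measure]_(s in `]t, r]) integrand g r s.
Proof.
move=> gc tt tr rT; have t_ge0 := le_trans t0_ge0 tt.
have gPhi := flow_bounded_lip gc t_ge0 tr rT.
have t0r : t0 <= r <= T by rewrite (le_trans tt).
have t0t : t0 <= t <= T by rewrite tt (le_trans tr).
rewrite (mild_pairing gc t0r) (mild_pairing gPhi t0t).
have PhiE s : t0 <= s <= t -> (g \o Phi t r) \o Phi s t = g \o Phi s r.
  move=> /andP[ts st]; apply/funext => x /=.
  by rewrite (flow_comp hv hPhi _ (le_trans t0_ge0 ts)).
rewrite PhiE ?lexx// -addrA; congr (_ + _).
have -> : \int[lebesgue_measure]_(s in `[t0, t]) integrand (g \o Phi t r) t s =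
    \int[lebesgue_measure]_(s in `[t0, t]) integrand g r s.
  apply: eq_Rintegral => s; rewrite inE/= in_itv/= /integrand => st.
  by rewrite PhiE.
rewrite -(Rintegral_itvB (x := t) (integrand_integrable gc t0r)) ?bnd_simp//.
ring.
Qed.

(** The integrand in the Duhamel formula is frozen at the initial time; its
    variation is small uniformly over the test functions. *)
Lemma euler_step t e : t0 <= t < T -> 0 < e -> exists2 r0 : R, 0 < r0 &
  forall g r, bounded_lip 1 g -> t < r < t + r0 -> r <= T ->
  `|pairing (mu r) g - pairing (mu t) (g \o Phi t r)
    - (r - t) * pairing (f t (mu t)) (g \o Phi t r)| <= e * (r - t).
Proof.
move=> /andP[tt tT] e0.
have [|r0 r00 hr] := @integrand_near 1 t e ler01 _ e0; first by rewrite tt ltW.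
exists r0 => // g r g1 /andP[tr trr] rT.
rewrite (duhamel g1 tt (ltW tr) rT) [X in `|X - _|]addrAC subrr add0r.
have cst_int (a : R) : \int[lebesgue_measure]_(s in `]t, r]) a = (r - t) * a.
  by rewrite Rintegral_cst//= lebesgue_measure_itv/= lte_fin tr -EFinD mulrC.
have icst (a : R) : lebesgue_measure.-integrable `]t, r] (EFin \o cst a).
  apply: measurable_bounded_integrable => //.
    by rewrite /= lebesgue_measure_itv/= lte_fin tr -EFinD ltry.
  by exists `|a|; split => // M aM x _ /=; exact: ltW.
have sub : `]t, r]%classic `<=` `[t0, r]%classic.
  by move=> s /=; rewrite !in_itv/= => /andP[ts ->]; rewrite (le_trans tt (ltW ts)).
have ig : lebesgue_measure.-integrable `]t, r] (EFin \o integrand g r).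
  have := integrand_integrable g1 (_ : t0 <= r <= T).
  rewrite (le_trans tt (ltW tr)) => /(_ rT).
  by apply: integrableS.
rewrite -[X in _ - X]cst_int -RintegralB//; last exact: (icst (integrand g r t)).
have iB : lebesgue_measure.-integrable `]t, r]
    (EFin \o (fun s => integrand g r s - integrand g r t)).
  by apply: (integrableB _ ig (icst (integrand g r t))); exact: measurable_itv.
apply: (le_trans (le_normr_Rintegral _ iB)); first exact: measurable_itv.
rewrite mulrC -cst_int; apply: le_Rintegral => //.
- exact: integrable_norm iB.
- exact: icst.
- move=> s /=; rewrite in_itv/= => /andP[ts sr]; apply: ltW; rewrite distrC.
  apply: hr => //; first by rewrite (le_trans tt (ltW ts)).
    exact: ltW.
  by rewrite distrC gtr0_norm ?subr_gt0//; lra.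
Qed.

End mild.

(** * The distance to the cone of positive charges *)

Section cone.
Context {R : realType} {d : nat} {k : domain}.
Local Notation M := (Mspace R d k).
Variables (B : completeNormedModType R) (iota : M -> B).
Hypothesis hB : is_fm_completion iota.
Implicit Types (b : B) (m : M).

Let gaps b : set R := [set `|b - iota m| | m in [set m : M | positive_charge m]].

Definition cone_dist b : R := inf (gaps b).

Lemma positive_czero : positive_charge (czero : M).
Proof. by move=> A _. Qed.

Let gaps_neq0 b : gaps b !=set0.
Proof. by exists `|b - iota czero|, czero => //; exact: positive_czero. Qed.

Let gaps_lb b : has_lbound (gaps b).
Proof. by exists 0 => _ [m _ <-]. Qed.

Lemma cone_dist_le b m : positive_charge m -> cone_dist b <= `|b - iota m|.
Proof. by move=> m0; apply: ge_inf => //; exists m. Qed.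

Lemma cone_dist_ge0 b : 0 <= cone_dist b.
Proof. by apply: lb_le_inf => // _ [m _ <-]. Qed.

Lemma cone_dist_approx b (e : R) : 0 < e ->
  exists2 m, positive_charge m & `|b - iota m| < cone_dist b + e.
Proof.
move=> e0; have [_ [m m0 <-] h] := inf_adherent e0 (conj (gaps_neq0 b) (gaps_lb b)).
by exists m.
Qed.

Lemma cone_dist_lip b b' : `|cone_dist b - cone_dist b'| <= `|b - b'|.
Proof.
suff h (u w : B) : cone_dist u - cone_dist w <= `|u - w|.
  by rewrite ler_norml h andbT lerNl opprB distrC h.
rewrite lerBlDr -lerBlDl; apply: lb_le_inf => // _ [m m0 <-].
rewrite lerBlDl (le_trans (cone_dist_le _ m0))//.
exact: ler_distD.
Qed.

Lemma cone_dist_tv m : cone_dist (iota m) <= tv m.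
Proof.
apply: (le_trans (cone_dist_le _ positive_czero)).
rewrite (iota_czero hB) subr0 -lee_fin; have [_ -> _] := hB.
exact: fm_norm_le_tv.
Qed.

(** The cone is closed, because it is cut out by the pairings with nonnegative
    test functions. *)
Lemma cone_dist0 m : cone_dist (iota m) = 0 -> positive_charge m.
Proof.
move=> m0; apply: positive_of_pairing => c g gc g0.
have c0 := bounded_lip_ge0 gc; have bg := bounded_lip_measurable gc.
rewrite -oppr_le0; apply/ler_addgt0Pr => e e0; rewrite add0r.
have c1 : 0 < c + 1 by rewrite ltr_wpDl.
have [p p0] := cone_dist_approx (iota m) (divr_gt0 e0 c1).
rewrite m0 add0r => /ltW mp.
have := pairing_iota hB m p gc; rewrite ler_norml => /andP[+ _].
have := pairing_ge0 p0 bg g0.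
have : c * `|iota m - iota p| <= e.
  rewrite -[leRHS](@divfK _ (c + 1)) ?gt_eqF// [leRHS]mulrC.
  by apply: ler_pM => //; rewrite lerDl.
lra.
Qed.

End cone.

Section charge_operations.
Context {dsp : measure_display} {T : measurableType dsp} {R : realType}.
Implicit Types (m p q : charge T R).

Lemma positive_push (phi : T -> T) m : measurable_fun setT phi ->
  positive_charge m -> positive_charge (push phi m).
Proof.
move=> mphi m0 A mA; rewrite /push; case: pselect => // mphi'.
by apply: m0; rewrite -[X in measurable X]setTI; exact: mphi.
Qed.

(** On every set the new value is at least (1 - h C) m + h p. *)
Lemma positive_euler (m q p : charge T R) (F : T -> R) (C h : R) :
  positive_charge m -> positive_charge p -> bounded_measurable F ->
  (forall x, `|F x| <= C) ->
  (forall A, measurable A -> q A = p A + charge_integral m A F)%E ->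
  0 <= h -> h * C <= 1 -> positive_charge (cadd m (cscale h q)).
Proof.
move=> m0 p0 bF FC qE h0 hC1 A mA.
change (0 <= m A + h%:E * q A)%E; rewrite qE//.
have mA0 := m0 A mA.
have ic := positive_integral_ge m0 mA bF FC.
have : (- (C%:E * m A) <= p A + charge_integral m A F)%E.
  by rewrite -[leLHS]add0e leeD// p0.
have h0' : (0 <= h%:E)%E by rewrite lee_fin.
move=> /(lee_wpmul2l h0') hq.
apply: le_trans (leeD2l (m A) hq).
have : m A \is a fin_num by exact: fin_num_measure.
move: (m A) mA0 => [x| |]// x0 _.
rewrite lee_fin in x0; change (0 <= (x + h * - (C * x))%:E)%E; rewrite lee_fin.
have := ler_wpM2r x0 hC1; rewrite mul1r; lra.
Qed.

End charge_operations.

(** Only an upper right Dini derivative is controlled, so the proof is a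
    continuous induction: for each slope e, the barrier
    e (t - a) exp (K (t - a)) cannot be crossed. *)
Lemma forward_gronwall {R : realType} (D : R -> R) (K a b : R) : 0 <= K ->
  D a <= 0 ->
  (forall t, a <= t <= b -> forall e, 0 < e -> exists2 r : R, 0 < r &
     forall s, a <= s <= b -> `|t - s| < r -> `|D t - D s| < e) ->
  (forall t e, a <= t < b -> 0 < e -> exists2 r0 : R, 0 < r0 &
     forall r, t < r < t + r0 -> r <= b ->
       D r <= expR (K * (r - t)) * D t + e * (r - t)) ->
  forall t, a <= t <= b -> D t <= 0.
Proof.
move=> K0 Da cD step t tab.
pose bnd e s := e * (s - a) * expR (K * (s - a)).
suff h e : 0 < e -> forall s, a <= s <= b -> D s <= bnd e s.
  apply/ler_addgt0Pr => e e0; rewrite add0r.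
  pose q := (t - a) * expR (K * (t - a)).
  have q0 : 0 <= q by rewrite mulr_ge0 ?expR_ge0// subr_ge0; case/andP: tab.
  have q1 : 0 < q + 1 by rewrite ltr_wpDl.
  apply: (le_trans (h (e / (q + 1)) (divr_gt0 e0 q1) t tab)).
  rewrite /bnd -mulrA -/q mulrAC ler_pdivrMr// ler_wpM2l ?ltW//; lra.
move=> e0; apply: real_induction.
- by rewrite /bnd subrr mulr0 mul0r.
- move=> s /andP[as_ sb] Ds; have [|r0 r00 hr] := step s e _ e0; first by rewrite as_.
  exists r0 => // r srr rb; apply: (le_trans (hr r srr rb)).
  move: srr => /andP[sr _].
  apply: (@le_trans _ _
      (expR (K * (r - s)) * bnd e s + e * (r - s) * expR (K * (r - a)))).
    rewrite lerD//; first by rewrite ler_wpM2l// expR_ge0.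
    rewrite ler_peMr//; first by rewrite mulr_ge0 ?(ltW e0)// subr_ge0 ltW.
    by rewrite -expR0 ler_expR mulr_ge0// subr_ge0 (le_trans as_)// ltW.
  rewrite /bnd mulrCA -expRD.
  rewrite (_ : K * (r - s) + K * (s - a) = K * (r - a)); last by ring.
  by rewrite -mulrDl -mulrDr; apply: ler_wpM2r; rewrite ?expR_ge0//
    ler_wpM2l ?(ltW e0)//; lra.
- move=> s /andP[as_ sb] hs; rewrite leNgt; apply/negP => Ds.
  have sab : a <= s <= b by rewrite sb ltW.
  have Ds0 : 0 < D s - bnd e s by rewrite subr_gt0.
  have [r r0 hr] := cD s sab _ Ds0.
  (* An earlier time within the radius of continuity at s. *)
  pose s' := Num.max a (s - r / 2).
  have as' : a <= s' by rewrite /s' le_max lexx.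
  have s's : s' < s by rewrite /s' gt_max as_ ltrBlDr ltrDl divr_gt0.
  have srs' : s - r / 2 <= s' by rewrite /s' le_max lexx orbT.
  have s'ab : a <= s' <= b by rewrite as' (le_trans (ltW s's)).
  have ss'r : `|s - s'| < r by rewrite gtr0_norm ?subr_gt0//; lra.
  have := hr s' s'ab ss'r.
  have bs' : bnd e s' <= bnd e s.
    rewrite /bnd; apply: ler_pM; rewrite ?expR_ge0//.
    * by rewrite mulr_ge0 ?(ltW e0)// subr_ge0.
    * by rewrite ler_wpM2l ?(ltW e0)// lerD2r ltW.
    * by rewrite ler_expR ler_wpM2l// lerD2r ltW.
  have := hs s'; rewrite as' s's => /(_ isT) Ds'.
  by rewrite ltr_norml => /andP[_]; lra.
Qed.

(** * Positivity of mild solutions *)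

Section positivity_of_solutions.
Context {R : realType} {d : nat} {k : domain}.
Local Notation X := (Omega R d k).
Local Notation M := (Mspace R d k).
Variables (v : R -> X -> 'rV[R]_d) (Phi : R -> R -> X -> X) (f : R -> M -> M).
Variables (B : completeNormedModType R) (iota : M -> B).
Variables (p : R -> M -> M) (F : R -> M -> X -> R).
Variables (t0 T : R) (nu : M) (mu : R -> M).
Hypotheses (hv : velocity_field v) (hPhi : flow_map v Phi).
Hypothesis hf : reaction_map f.
Hypothesis hB : is_fm_completion iota.
Hypothesis hp : forall t m, 0 <= t -> positive_charge (p t m).
Hypothesis hF : forall t m, 0 <= t -> BL absr (F t m).
Hypothesis hfpF : forall t m, 0 <= t -> forall A, measurable A ->
  f t m A = (p t m A + charge_integral m A (F t m))%E.
Hypothesis hFbound : forall r S : R, 0 < r -> 0 < S -> exists2 C : R, 0 < C &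
  forall m : M, positive_charge m -> (tv_norm m <= r%:E)%E ->
    (ereal_sup [set sup_norm absr (F t m) | t in `[0%R, S]] <= C%:E)%E.
Hypotheses (t0_ge0 : 0 <= t0) (t0T : t0 < T) (hnu : positive_charge nu).
Hypothesis hmu : mild_solution Phi f iota t0 nu T mu.
Implicit Types (s t r e : R) (m : M).

Let D t := cone_dist iota (iota (mu t)).

Let T0 : 0 < T. Proof. exact: le_lt_trans t0T. Qed.

Let D_continuous t : t0 <= t <= T -> forall e, 0 < e -> exists2 r, 0 < r &
  forall s, t0 <= s <= T -> `|t - s| < r -> `|D t - D s| < e.
Proof.
move=> tT e e0; have [cmu _ _] := hmu.
have tI : `[t0, T]%classic t by rewrite /= in_itv.
have [r r0 hr] := cmu t tI e e0; exists r => // s sT ts.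
have sI : `[t0, T]%classic s by rewrite /= in_itv.
apply: (le_lt_trans (cone_dist_lip _ _ _)).
by rewrite -lte_fin -(fm_distE hB); apply: hr.
Qed.

Let tv_bounded : exists2 r : R, 0 < r & forall t, t0 <= t <= T -> tv (mu t) <= r.
Proof.
have [_ hs _] := hmu; have tvs t : t0 <= t <= T ->
    (tv_norm (mu t) <= ereal_sup [set tv_norm (mu t) | t in `[t0, T]])%E.
  by move=> tT; apply: ereal_sup_ubound; exists t => //=; rewrite in_itv.
move: hs tvs; case: (ereal_sup _) => [r _ h| //|_ h].
  exists (Num.max r 1); first by rewrite lt_max ltr01 orbT.
  by move=> t /h; rewrite tv_norm_le => tr; rewrite le_max tr.
exists 1 => // t /h tN; rewrite -tv_norm_le.
exact: le_trans tN (leNye _).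
Qed.

Let F_bound r : 0 < r -> exists2 C : R, 0 < C &
  forall t m, 0 <= t <= T -> positive_charge m -> tv m <= r ->
    forall x, `|F t m x| <= C.
Proof.
move=> r0; have [C C0 hC] := hFbound r0 T0; exists C => // t m tT m0 mr.
apply/(sup_norm_leP (nrm := absr)).
rewrite -tv_norm_le in mr; apply: le_trans (hC m m0 mr).
by apply: ereal_sup_ubound; exists t => //=; rewrite in_itv.
Qed.

Let D_start : D t0 <= 0.
Proof.
have [C C0 hC] := velocity_bounded hv (ltW T0).
have t0I : t0 <= t0 <= T by rewrite lexx ltW.
have Phi_mes : measurable_fun setT (Phi t0 t0).
  exact: flow_measurable hv hPhi _ _ t0_ge0 (lexx _).
have q0 := positive_push Phi_mes hnu.
apply: (le_trans (cone_dist_le _ _ q0)).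
rewrite -lee_fin -(fm_distE hB); apply/fm_norm_leP => g g1.
have bg := bounded_lip_measurable g1.
rewrite pairing_sub// pairing_push//.
rewrite (mild_pairing hv hPhi hf hB t0_ge0 (ltW C0) hC hmu g1 t0I).
by rewrite set_itv1 Rintegral_set1 addr0 subrr.
Qed.

(** Viability estimate: a positive charge that nearly realizes the distance at
    time t is moved by one Euler step along the flow; the result is positive,
    and its distance to the solution is controlled by the Lipschitz constants
    of the flow and of the reaction. *)
Let D_step : exists2 K : R, 0 <= K & forall t e, t0 <= t < T -> 0 < e ->
  exists2 r0 : R, 0 < r0 & forall r, t < r < t + r0 -> r <= T ->
    D r <= expR (K * (r - t)) * D t + e * (r - t).
Proof.
have [C C0 hC] := velocity_bounded hv (ltW T0).
have [V V0 hV] := tv_bounded.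
(* Near-optimal positive charges have mass at most V + (V + 1). *)
have V1 : 0 < 2 * V + 1 by lra.
have [L L0 hL] : exists2 L : R, 0 < L & forall t m m', 0 <= t <= T ->
    tv m <= 2 * V + 1 -> tv m' <= 2 * V + 1 ->
    `|iota (f t m) - iota (f t m')| <= L * `|iota m - iota m'|.
  have [_ /(_ T (2 * V + 1) (ltW T0) V1)[L L0 hL] _] := hf; exists L => // t m m' tT.
  rewrite -!tv_norm_le => mr m'r; rewrite -lee_fin EFinM -!(fm_distE hB).
  exact: hL.
have [CF CF0 hCF] := F_bound V1.
exists (C + L); first by rewrite addr_ge0// ltW.
move=> t e /andP[tt tT] e0; have t_ge0 := le_trans t0_ge0 tt.
have [|r0 r00 hr] := euler_step hv hPhi hf hB t0_ge0 (ltW C0) hC hmu (t := t) _ e0.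
  by rewrite tt.
exists (Num.min r0 CF^-1); first by rewrite lt_min r00 invr_gt0.
move=> r /andP[tr]; rewrite -ltrBlDl lt_min => /andP[rr0 rCF] rT.
have h0 : 0 < r - t by rewrite subr_gt0.
set h := r - t in h0 rr0 rCF *.
have tI : 0 <= t <= T by rewrite t_ge0 ltW.
have gronwall_approx e' : 0 < e' -> e' <= 1 ->
    D r <= expR ((C + L) * h) * (D t + e') + e * h.
  move=> e'0 e'1; have [m m0 mum] := cone_dist_approx iota (iota (mu t)) e'0.
  have tvt : tv (mu t) <= V by apply: hV; rewrite tt ltW.
  have tvm : tv m <= 2 * V + 1.
    rewrite tv_positive//.
    have := pairing_iota hB (mu t) m (bounded_lip1 (R := R) (d := d) (k := k)).
    rewrite mul1r ler_norml => /andP[mum1 _].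
    have := cone_dist_tv hB (mu t).
    have : pairing (mu t) (cst 1) <= tv (mu t).
      rewrite (le_trans (ler_norm _))// -[leRHS]mul1r.
      apply: pairing_le_tv; first exact: bounded_measurable_cst.
      by move=> x; rewrite normr1.
    lra.
  have [cF _ bF] := BL_bounded_lip (hF m t_ge0).
  have euler_ge0 : positive_charge (cadd m (cscale h (f t m))).
    apply: (positive_euler m0 (hp m t_ge0) (bounded_lip_measurable bF)
              (hCF t m tI m0 tvm) (hfpF m t_ge0) (ltW h0)).
    by rewrite -ler_pdivlMr// div1r ltW.
  have Phi_mes := flow_measurable hv hPhi t_ge0 (ltW tr).
  apply: (le_trans (cone_dist_le _ _ (positive_push Phi_mes euler_ge0))).
  rewrite -lee_fin -(fm_distE hB); apply/fm_norm_leP => g g1.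
  have bg := bounded_lip_measurable g1.
  have gPhi := flow_bounded_lip hPhi (ltW C0) hC g1 t_ge0 (ltW tr) rT.
  have bgPhi := bounded_lip_measurable gPhi.
  rewrite pairing_sub// pairing_push// pairing_cadd// pairing_cscale//.
  have trr : t < r < t + r0 by rewrite tr -ltrBlDl.
  have := hr g r g1 trr rT; rewrite -/h => /(le_trans (ler_norm _)) => h1.
  have := pairing_iota hB (mu t) m gPhi => /(le_trans (ler_norm _)).
  have := pairing_iota hB (f t (mu t)) (f t m) gPhi => /(le_trans (ler_norm _)).
  have := hL t (mu t) m tI _ tvm => /(_ ltac:(lra)).
  have expD : expR (C * h) * (1 + h * L) <= expR ((C + L) * h).
    rewrite [(C + L) * h]mulrDl expRD ler_wpM2l ?expR_ge0// [h * L]mulrC.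
    exact: expR_ge1Dx.
  rewrite -/h mulr1; set E := expR (C * h); have E0 : 0 < E := expR_gt0 _.
  move=> hf1 hf2 hmu1.
  have mum' := ltW mum; rewrite -/(D t) in mum'.
  set a := `|iota (mu t) - iota m| in mum' hf1 hmu1.
  have a0 : 0 <= a by rewrite normr_ge0.
  have hf3 : h * (pairing (f t (mu t)) (g \o Phi t r) - pairing (f t m) (g \o Phi t r)) <=
      h * (E * (L * a)).
    by rewrite ler_wpM2l ?(ltW h0)// (le_trans hf2)// ler_wpM2l ?(ltW E0).
  have total : E * a + h * (E * (L * a)) <= expR ((C + L) * h) * (D t + e').
    have -> : E * a + h * (E * (L * a)) = E * (1 + h * L) * a by ring.
    by apply: ler_pM => //; rewrite mulr_ge0 ?(ltW E0)// addr_ge0// mulr_ge0 ?ltW.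
  lra.
apply/ler_addgt0Pr => e' e'0.
pose q := expR ((C + L) * h); have q0 : 0 < q by exact: expR_gt0.
pose e'' := Num.min 1 (e' / q).
have e''0 : 0 < e'' by rewrite lt_min ltr01 divr_gt0.
have [e''1 e''q] : e'' <= 1 /\ q * e'' <= e'.
  split; first by rewrite ge_min lexx.
  by rewrite mulrC -ler_pdivlMr// ge_min lexx orbT.
have := gronwall_approx e'' e''0 e''1; rewrite -/q mulrDr; lra.
Qed.

Lemma mild_solution_positive t : t0 <= t <= T -> positive_charge (mu t).
Proof.
move=> tT; have [K K0 step] := D_step.
apply: (cone_dist0 hB); apply/eqP; rewrite eq_le cone_dist_ge0 andbT.
exact: (forward_gronwall K0 D_start D_continuous step).
Qed.

End positivity_of_solutions.

Theorem theorem4p1 (R : realType) (d : nat) (k : domain)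
  (v : R -> Omega R d k -> 'rV[R]_d)
  (Phi : R -> R -> Omega R d k -> Omega R d k)
  (f : R -> Mspace R d k -> Mspace R d k)
  (B : completeNormedModType R) (iota : Mspace R d k -> B)
  (p : R -> Mspace R d k -> Mspace R d k)
  (F : R -> Mspace R d k -> Omega R d k -> R)
  (t0 : R) (nu : Mspace R d k)
  (Tmax : \bar R) (mu : R -> Mspace R d k)
  (hv : velocity_field v) (hPhi : flow_map v Phi)
  (hf : reaction_map f)
  (hB : is_fm_completion iota)
  (hp : forall (t : R) m, 0 <= t -> positive_charge (p t m))
  (hF : forall (t : R) m, 0 <= t -> BL absr (F t m))
  (hfpF : forall (t : R) m, 0 <= t -> forall A, measurable A ->
     f t m A = (p t m A + charge_integral m A (F t m))%E)
  (hFbound : forall r T : R, 0 < r -> 0 < T -> exists2 C : R, 0 < C &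
     forall m : Mspace R d k,
       positive_charge m -> (tv_norm m <= r%:E)%E ->
       (ereal_sup [set sup_norm absr (F t m) | t in `[0%R, T]] <= C%:E)%E)
  (ht0 : 0 <= t0) (hnu : positive_charge nu)
  (hmu : maximal_mild_solution Phi f iota t0 nu Tmax mu) :
  forall t : R, t0 <= t -> (t%:E < Tmax)%E -> positive_charge (mu t).
Proof.
move=> t tt tTmax; have [_ sol _] := hmu.
have [T tT TTmax] : exists2 T : R, t < T & (T%:E < Tmax)%E.
  case: Tmax tTmax {hmu sol} => [x||] //; last by exists (t + 1); rewrite ?ltrDl ?ltry.
  by rewrite lte_fin => tx; exists ((t + x) / 2); rewrite ?lte_fin; lra.
have t0T := le_lt_trans tt tT.
apply: (mild_solution_positive hv hPhi hf hB hp hF hfpF hFbound ht0 t0T hnu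
          (sol T t0T TTmax)).
by rewrite tt ltW.
Qed.
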